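(* Let $n\geq 12$ be an even integer and let $l=2\lceil\frac{n}{4}\rceil+1$. Among all crg trees on $n$ vertices, the distance between center and centroid is maximized by the tree $T_{rg}^{n,l}$; that is, for every odd $m$ with $3\leq m<n$, $$d_{T_{rg}^{n,m}}\big(C(T_{rg}^{n,m}),C_d(T_{rg}^{n,m})\big)\leq d_{T_{rg}^{n,l}}\big(C(T_{rg}^{n,l}),C_d(T_{rg}^{n,l})\big).$$
   Context: All graphs are finite, simple, connected and undirected. A pendant vertex is a vertex of degree $1$. A binary tree is a tree in which every non-pendant vertex has degree $3$. Center and centroid: the eccentricity of $v\in V(T)$ is $e(v)=\max_{u}d_T(u,v)$; the center $C(T)$ is the set of vertices of minimum eccentricity. A branch at $v$ is a maximal subtree of $T$ containing $v$ as a pendant vertex; the weight of $v$ is the maximum number of edges in a branch at $v$; the centroid $C_d(T)$ is the set of vertices of minimum weight. For $X,Y\subseteq V(T)$, $d_T(X,Y)=\min\{d_T(x,y):x\in X,y\in Y\}$. Rooted binary trees: a rooted binary tree is a rooted tree whose root has degree $2$ and in which every other vertex has degree $1$ or $3$; the single-vertex rooted tree is also allowed. The height (level) of a vertex is its distance to the root. A rooted binary tree is ordered if the vertices of each level $l\ge 1$ are linearly ordered so that two vertices at level $l+1$ with different parents are ordered as their parents are at level $l$. A rooted binary tree is rgood if (i) the heights of any two of its pendant vertices differ by at most $1$, and (ii) it can be ordered so that the parents of the pendant vertices at the highest level form a final segment in the ordering of the vertices at the next-to-highest level. For each odd $l$ there is, up to isomorphism, exactly one rgood binary tree on $l$ vertices,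 denoted $T_{rg}^l$. Crg trees: a binary caterpillar is a binary tree having a path such that every vertex not on the path is adjacent to a vertex of the path. For even $n\ge 4$ and odd $l$ with $3\le l<n$, the crg tree $T_{rg}^{n,l}$ is the tree on $n$ vertices obtained by identifying the root of $T_{rg}^l$ with a vertex of maximum eccentricity of a binary caterpillar on $n-l+1$ vertices. *)

(* Defs.v *)
From mathcomp Require Import all_boot.

Set Implicit Arguments.
Unset Strict Implicit.
Unset Printing Implicit Defensive.

Record sgraph := SGraph {
  svertex :> finType;
  adj : rel svertex;
  adj_sym : symmetric adj;
  adj_irr : irreflexive adj
}.

Definition isomorphic (G H : sgraph) : Prop :=
  exists2 f : G -> H, bijective f & forall x y, adj (f x) (f y) = adj x y.

Section Graphs.
Variable G : sgraph.
Implicit Types (x y u v : G) (B : {set G}).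

Definition deg_in B v : nat := #|[set u in B | adj v u]|.
Definition deg v : nat := deg_in setT v.
Definition pendant v : bool := deg v == 1.

Definition edges_in B : {set {set G}} :=
  [set [set x; y] | x in B, y in B & adj x y].

(* connectedness of the subgraph induced by B; the empty set is excluded *)
Definition connected_in B : bool :=
  (B != set0) &&
  [forall x in B, forall y in B,
     connect [rel u v | [&& u \in B, v \in B & adj u v]] x y].

(* ucycle also holds of [:: x; y] for adjacent x, y and of [::]: these
   degenerate closed walks are the ones of size at most 2 *)
Definition acyclic : Prop := forall c : seq G, ucycle (@adj G) c -> size c <= 2.

Definition is_tree : Prop := connected_in setT /\ acyclic.

Definition walk (k : nat) x y : bool :=
  [exists p : k.-tuple G, path (@adj G) x p && (last x p == y)].

(* The default value #|G| is reached only if y is not reachable from x, as the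
   distance in a connected graph is less than #|G|. *)
Definition dist x y : nat := \big[minn/#|G|]_(k < #|G| | walk k x y) k.

(* The default value #|G| plays no role for nonempty X, Y in a connected G. *)
Definition set_dist (X Y : {set G}) : nat :=
  \big[minn/#|G|]_(x in X) \big[minn/#|G|]_(y in Y) dist x y.

Definition ecc v : nat := \max_(u : G) dist u v.
Definition center : {set G} := [set v | [forall u, ecc v <= ecc u]].

(* A subtree of a tree is the subgraph induced by its vertex set, so branches
   are represented by their vertex sets. *)
Definition branch v B : bool :=
  maxset [pred A : {set G} |
    [&& connected_in A, v \in A & deg_in A v == 1]] B.
Definition weight v : nat := \max_(B | branch v B) #|edges_in B|.
Definition centroid : {set G} := [set v | [forall u, weight v <= weight u]].

Definition binary_tree : Prop :=
  is_tree /\ forall v, ~~ pendant v -> deg v = 3.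

Definition binary_caterpillar : Prop :=
  binary_tree /\
  exists x (p : seq G),
    [/\ path (@adj G) x p, uniq (x :: p) &
        forall v, v \notin x :: p -> exists2 u, u \in x :: p & adj v u].

Section Rooted.
Variable r : G.

Definition rooted_binary_tree : Prop :=
  is_tree /\
  (#|G| = 1 \/
   deg r = 2 /\ forall v, v != r -> deg v = 1 \/ deg v = 3).

Definition height v : nat := dist v r.
Definition parent u v : bool := adj u v && (height v == (height u).+1).
Definition max_height : nat := \max_(v : G) height v.

(* Only the restrictions of lt to the levels k >= 1 are meaningful. *)
Definition tree_ordering (lt : rel G) : Prop :=
  [/\ forall u, 1 <= height u -> ~~ lt u u,
      forall u v w, 1 <= height u -> height u = height v ->
        height v = height w -> lt u v -> lt v w -> lt u w,
      forall u v, 1 <= height u -> height u = height v ->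
        u != v -> lt u v || lt v u
    & forall u v u' v', 1 <= height u -> height u = height v -> u != v ->
        parent u u' -> parent v v' -> lt u' v' = lt u v].

Definition parent_of_lowest u : bool :=
  [exists v, [&& pendant v, height v == max_height & parent u v]].

Definition rgood : Prop :=
  [/\ rooted_binary_tree,
      forall u v, pendant u -> pendant v -> height u <= (height v).+1
    & exists2 lt : rel G, tree_ordering lt &
        forall u w, (height u).+1 = max_height -> (height w).+1 = max_height ->
          lt u w -> parent_of_lowest u -> parent_of_lowest w].

End Rooted.
End Graphs.

Section Identify.
Variables (R C : sgraph) (r : R) (c : C).

(* Disjoint union of R and C with c identified with r: the merged vertex is
   inl r, and c itself is removed from C. *)
Definition identify_vertex : finType := (R + {v : C | v != c})%type.

Definition identify_adj : rel identify_vertex := fun a b =>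
  match a, b with
  | inl x, inl y => adj x y
  | inr u, inr v => adj (val u) (val v)
  | inl x, inr u | inr u, inl x => (x == r) && adj c (val u)
  end.

Fact identify_sym : symmetric identify_adj.
Proof. by move=> [x|u] [y|v] //=; apply: adj_sym. Qed.

Fact identify_irr : irreflexive identify_adj.
Proof. by move=> [x|u] /=; apply: adj_irr. Qed.

Definition identify : sgraph := SGraph identify_sym identify_irr.

End Identify.

(* G is (a copy of) the crg tree with parameters n, l. *)
Definition is_crg (n l : nat) (G : sgraph) : Prop :=
  [/\ ~~ odd n, 4 <= n, odd l & 3 <= l < n] /\
  exists (R C : sgraph) (r : R) (c : C),
    [/\ rgood r /\ #|R| = l,
        binary_caterpillar C /\ #|C| = n - l + 1,
        forall u : C, ecc u <= ecc c
      & isomorphic G (identify r c)].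

Definition ceil_divn (a b : nat) : nat := (a + b.-1) %/ b.

(* Main.v *)
Require Import Defs.
From mathcomp Require Import all_boot zify.

(* Write n = 4k + 2e with e <= 1.  The crg tree with parameter m is rooted at
   the identified vertex r: one child of r starts a caterpillar whose deepest
   vertices are at distance D = (n - m + 1)/2 from r, the other two children
   carry the rgood tree, of height h with 2^h <= m < 2^(h+1).  If h <= D, the
   vertex at distance floor((D - h)/2) from r on the spine is central, and
   otherwise r is.  A vertex is in the centroid as soon as every component of
   its complement has at most n/2 vertices.
   For m = l one has D = k and the centroid is {r}, so the distance is at least
   floor((k - h_l)/2).  For m = l - 2j the spine vertex at distance j from r (or
   j - 1) is in the centroid, and h_l <= h + j bounds the distance.  For m > l
   the centroid contains r or a child of r; in the latter case the rgood tree is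
   so large that D < k/2, which makes up for the additional edge, the few cases
   with k <= 4 being those where this child is itself central. *)

Set Implicit Arguments.
Unset Strict Implicit.
Unset Printing Implicit Defensive.

(** * Distances and centers *)

Section BigMin.
Variables (I : finType) (P : pred I) (F : I -> nat) (N : nat).

Lemma bigmin_leq_idx : \big[minn/N]_(i | P i) F i <= N.
Proof. by elim/big_rec: _ => // i m _ le_mN; rewrite geq_min le_mN orbT. Qed.

Lemma bigmin_leq i : P i -> \big[minn/N]_(j | P j) F j <= F i.
Proof.
move=> Pi; move: (mem_index_enum i); elim: (index_enum I) => // j s IHs.
rewrite inE big_cons; case/predU1P => [<-|/IHs le_s]; first by rewrite Pi geq_min leqnn.
by case: ifP => // _; rewrite geq_min le_s orbT.
Qed.

Lemma leq_bigmin m :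
  m <= N -> (forall i, P i -> m <= F i) -> m <= \big[minn/N]_(i | P i) F i.
Proof. by move=> leN leF; elim/big_ind: _ => // x y; rewrite leq_min => -> ->. Qed.

Lemma bigmin_attained : \big[minn/N]_(i | P i) F i = N \/
  exists2 i, P i & \big[minn/N]_(i | P i) F i = F i.
Proof.
elim/big_rec: _ => [|i m Pi IHm]; first by left.
by rewrite /minn; case: ifP => _; [right; exists i | exact: IHm].
Qed.

End BigMin.

Section Distance.
Variable G : sgraph.
Implicit Types (x y z u v w : G) (p : seq G).

(** A path with at least [#|G|] edges satisfies the bound because [#|G|] is the default value of the
    minimum. *)
Lemma dist_leq_size x p : path (@adj G) x p -> dist x (last x p) <= size p.
Proof.
move=> xp; case: (ltnP (size p) #|G|) => [lt_p | le_p].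
  apply: (bigmin_leq _ _ (i := Ordinal lt_p)); apply/existsP.
  by exists (in_tuple p); rewrite xp /=.
exact: leq_trans (bigmin_leq_idx _ _ _) le_p.
Qed.

Lemma distxx x : dist x x = 0.
Proof. by apply/eqP; rewrite -leqn0; apply: (@dist_leq_size x [::]). Qed.

Lemma dist_adj x y : adj x y -> dist x y <= 1.
Proof. by move=> xy; apply: (@dist_leq_size x [:: y]); rewrite /= xy. Qed.

Hypothesis conn : forall x y, connect (@adj G) x y.

(** A repetition-free path has fewer than [#|G|] edges, so the minimum lies below its default value
    and is attained by a walk. *)
Lemma dist_geodesic x y :
  exists p, [/\ path (@adj G) x p, last x p = y & size p = dist x y].
Proof.
have [p xp ->] := connectP (conn x y); case/shortenP: xp => q xq uq _.
have lt_q : size q < #|G| by apply: leq_trans (max_card (mem (x :: q))); rewrite (card_uniqP uq).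
have [eqN|[k /existsP[t /andP[xt /eqP lt]] eqk]] :=
    bigmin_attained (fun k : 'I_#|G| => walk k x (last x q)) (@nat_of_ord _) #|G|.
  by have := dist_leq_size xq; rewrite /dist eqN leqNgt lt_q.
by exists t; rewrite size_tuple /dist eqk.
Qed.

(** Lower bounds on distances come from a well-chosen 1-Lipschitz function [f]; the triangle
    inequality and symmetry are instances as well. *)
Lemma dist_lipschitz (f : G -> nat) :
  (forall x y, adj x y -> f x <= (f y).+1) -> forall x y, f x <= f y + dist x y.
Proof.
move=> lip x y; have [p [xp <- <-]] := dist_geodesic x y.
elim: p x xp => [|z p IHp] x /=; first by rewrite addn0.
by case/andP=> xz /IHp le_z; have := lip x z xz; lia.
Qed.

Lemma dist_step x y z : adj x y -> dist x z <= (dist y z).+1.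
Proof.
move=> xy; have [p [yp <- <-]] := dist_geodesic y z.
by apply: (@dist_leq_size x (y :: p)); rewrite /= xy.
Qed.

Lemma dist_triangle y x z : dist x z <= dist x y + dist y z.
Proof.
have lip u v : adj u v -> dist u z <= (dist v z).+1 by apply: dist_step.
by rewrite addnC; apply: (dist_lipschitz lip).
Qed.

Lemma dist_sym x y : dist x y = dist y x.
Proof.
suff le u v : dist u v <= dist v u by apply/eqP; rewrite eqn_leq !le.
suff lip a b : adj a b -> dist u a <= (dist u b).+1.
  by have := dist_lipschitz lip v u; rewrite distxx.
have [p [up <- <-]] := dist_geodesic u b; rewrite adj_sym => ab.
have := @dist_leq_size u (rcons p a).
by rewrite rcons_path last_rcons size_rcons up; apply.
Qed.

Lemma dist_eq0 x y : dist x y = 0 -> x = y.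
Proof. by have [p [_ <- <-]] := dist_geodesic x y; case: p. Qed.

Lemma dist_leq_ecc x y : dist x y <= ecc y.
Proof. exact: (leq_bigmax x). Qed.

(** Every [u] satisfies [dist z w <= 2 * ecc u], hence [2 * e <= 2 * ecc u + 1] and, by parity,
    [e <= ecc u]. So a pair at distance [2 * e - 1] already suffices. *)
Lemma center_crit x z w (e : nat) :
  (forall u, dist u x <= e) -> 2 * e <= (dist z w).+1 -> x \in center G.
Proof.
move=> ecc_x far; rewrite inE; apply/forallP=> u.
have le_e : ecc x <= e by apply/bigmax_leqP => v _.
apply: leq_trans le_e _; have := dist_triangle u z w.
have := dist_leq_ecc z u; have := dist_leq_ecc w u; rewrite (dist_sym u w); lia.
Qed.

Lemma center_ecc x u (e : nat) :
  x \in center G -> (forall v, dist v u <= e) -> forall v, dist v x <= e.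
Proof.
rewrite inE => /forallP /(_ u) le_xu le_e v; apply: leq_trans (dist_leq_ecc v x) _.
by apply: leq_trans le_xu _; apply/bigmax_leqP.
Qed.

End Distance.

Lemma set_dist_leq (G : sgraph) (X Y : {set G}) x y :
  x \in X -> y \in Y -> set_dist X Y <= dist x y.
Proof.
move=> Xx Yy; apply: leq_trans (bigmin_leq _ _ Xx) _; exact: bigmin_leq.
Qed.

Lemma leq_set_dist (G : sgraph) (X Y : {set G}) m :
  m <= #|G| -> (forall x y, x \in X -> y \in Y -> m <= dist x y) ->
  m <= set_dist X Y.
Proof.
move=> leG le_m; apply: leq_bigmin => // x Xx; apply: leq_bigmin => // y Yy.
exact: le_m.
Qed.

(** * Rooted trees, branches and centroids *)

(** A rooted tree encoded by a parent map and a depth function. The parent map is total and fixes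
    the root, so it can be iterated freely; the depth drops at each step until [r] is reached. *)
Definition rooted_by (G : sgraph) (r : G) (par : G -> G) (dep : G -> nat) : Prop :=
  [/\ par r = r, dep r = 0, forall v, v != r -> dep v = (dep (par v)).+1
    & forall x y, adj x y = (x != r) && (y == par x) || (y != r) && (x == par y)].

Section Rooted.
Variables (G : sgraph) (r : G) (par : G -> G) (dep : G -> nat).
Hypothesis rootedG : rooted_by r par dep.
Implicit Types (u v w x y z : G) (B X : {set G}).

Lemma par_root : par r = r. Proof. by case: rootedG. Qed.
Lemma dep_root : dep r = 0. Proof. by case: rootedG. Qed.

Lemma dep_par v : v != r -> dep v = (dep (par v)).+1.
Proof. by case: rootedG => _ _ + _; apply. Qed.

Lemma rooted_adj x y :
  adj x y = (x != r) && (y == par x) || (y != r) && (x == par y).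
Proof. by case: rootedG. Qed.

Lemma adj_par v : v != r -> adj v (par v).
Proof. by move=> nr; rewrite rooted_adj nr eqxx. Qed.

Lemma dep_gt0 v : (0 < dep v) = (v != r).
Proof.
by case: (eqVneq v r) => [->|/dep_par ->]; rewrite ?dep_root.
Qed.

Lemma dep_par_pred v : dep (par v) = (dep v).-1.
Proof. by case: (eqVneq v r) => [->|/dep_par ->//]; rewrite par_root dep_root. Qed.

Lemma dep_iter i v : dep (iter i par v) = dep v - i.
Proof. by elim: i => [|i IHi]; rewrite ?subn0 //= dep_par_pred IHi; lia. Qed.

Lemma dep0_root v : dep v = 0 -> v = r.
Proof. by move=> d0; apply/eqP; rewrite -[_ == _]negbK -dep_gt0 d0. Qed.

Lemma iter_dep v : iter (dep v) par v = r.
Proof. by apply: dep0_root; rewrite dep_iter subnn. Qed.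

Lemma rooted_connect x y : connect (@adj G) x y.
Proof.
have to_root v : connect (@adj G) v r.
  rewrite -(iter_dep v); elim: (dep v) => //= i IHi; apply: connect_trans IHi _.
  case: (eqVneq (iter i par v) r) => [->|/adj_par/connect1//].
  by rewrite par_root.
apply: connect_trans (to_root x) _.
by rewrite (sym_connect_sym (@adj_sym G)).
Qed.

(** The descendants of [v], including [v]: those [w] whose ancestor at depth [dep v] is [v]. *)
Definition subt v := [set w | (dep v <= dep w) && (iter (dep w - dep v) par w == v)].

Lemma subt_dep v w : w \in subt v -> dep v <= dep w.
Proof. by rewrite inE => /andP[]. Qed.

Lemma subt_refl v : v \in subt v.
Proof. by rewrite inE leqnn subnn /=. Qed.

Lemma subt_par v w : w != r -> w != v -> (par w \in subt v) = (w \in subt v).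
Proof.
move=> wr wv; rewrite !inE (dep_par wr); case: (ltngtP (dep v) (dep (par w)).+1) => /=.
- by rewrite ltnS => le_v; rewrite le_v subSn // iterSr.
- by move=> gt_v; rewrite leqNgt (ltn_trans _ gt_v).
by move=> ->; rewrite ltnn subnn /= (negbTE wv).
Qed.

Lemma subt_root : subt r = [set: G].
Proof. by apply/setP=> w; rewrite !inE dep_root leq0n subn0 iter_dep eqxx. Qed.

Lemma mem_subt_root w : w \in subt r.
Proof. by rewrite subt_root. Qed.

Lemma subt_dep_eq x y : x \in subt y -> dep x = dep y -> x = y.
Proof. by rewrite inE => /andP[_ /eqP] + eqd; rewrite eqd subnn. Qed.

Lemma subt_dep_leq x y : x \in subt y -> dep x <= dep y -> x = y.
Proof. by move=> xy le; apply: subt_dep_eq (xy) _; have := subt_dep xy; lia. Qed.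

Lemma root_notin_subt v : v != r -> r \notin subt v.
Proof.
by apply: contra => rv; rewrite (subt_dep_leq rv) // dep_root.
Qed.

Lemma subt_comparable w x y :
  w \in subt x -> w \in subt y -> dep x <= dep y -> y \in subt x.
Proof.
rewrite !inE => /andP[lx /eqP ix] /andP[ly /eqP iy] le; rewrite le -[X in _ == X]ix.
rewrite (_ : dep w - dep x = (dep y - dep x) + (dep w - dep y)) ?iterD ?iy ?eqxx //.
lia.
Qed.

Lemma subt_eq w x y : w \in subt x -> w \in subt y -> dep x = dep y -> x = y.
Proof.
move=> wx wy eqd; apply: esym; apply: subt_dep_eq (esym eqd).
by apply: subt_comparable wx wy _; rewrite eqd.
Qed.

Lemma subt_trans x y z : x \in subt y -> y \in subt z -> x \in subt z.
Proof.
rewrite !inE => /andP[ly /eqP iy] /andP[lz /eqP iz]; rewrite (leq_trans lz ly).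
rewrite (_ : dep x - dep z = (dep y - dep z) + (dep x - dep y)); last by lia.
by rewrite iterD iy iz /=.
Qed.

Lemma subt_iter i w : i <= dep w -> w \in subt (iter i par w).
Proof.
by move=> le; rewrite inE dep_iter leq_subr subKn //=.
Qed.

Lemma dist_iter i w : dist w (iter i par w) <= i.
Proof.
elim: i => [|i IHi]; first by rewrite distxx.
have le := dist_triangle rooted_connect (iter i par w) w (iter i.+1 par w).
apply: leq_trans le _; rewrite -[in leqRHS]addn1 leq_add //=.
case: (eqVneq (iter i par w) r) => [->|/adj_par/dist_adj//].
by rewrite par_root distxx.
Qed.

Lemma dist_subt v w : w \in subt v -> dist w v <= dep w - dep v.
Proof. by rewrite inE => /andP[_ /eqP {1}<-]; apply: dist_iter. Qed.

Lemma dist_root w : dist w r = dep w.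
Proof.
apply/eqP; rewrite eqn_leq; apply/andP; split.
  by have := @dist_subt r w; rewrite subt_root inE dep_root subn0; apply.
have lip x y : adj x y -> dep x <= (dep y).+1.
  by rewrite rooted_adj => /orP[] /andP[_ /eqP->]; rewrite dep_par_pred; lia.
by have := dist_lipschitz rooted_connect lip w r; rewrite dep_root.
Qed.

Lemma subt_boundary v x y : adj x y -> x \in subt v -> y \notin subt v -> x = v.
Proof.
rewrite rooted_adj => /orP[] /andP[nr /eqP->] xv yv; apply/eqP; apply: contraNT yv => xnv.
  by rewrite subt_par.
rewrite -subt_par //; apply: contraTneq xv => yv; move: nr; rewrite yv -dep_gt0 => dv.
by apply/negP=> /subt_dep; rewrite dep_par_pred; lia.
Qed.

Definition children v := [set y | (y != r) && (par y == v)].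

Lemma childrenP v y : reflect (y != r /\ par y = v) (y \in children v).
Proof. by rewrite inE; apply: (iffP andP) => -[? /eqP]. Qed.

Lemma dep_child v y : y \in children v -> dep y = (dep v).+1.
Proof. by case/childrenP=> /dep_par -> ->. Qed.

Lemma adj_child v y : y \in children v -> adj v y.
Proof. by case/childrenP=> yr <-; rewrite adj_sym adj_par. Qed.

Lemma child_subt v y : y \in children v -> y \in subt v.
Proof.
move=> /childrenP[yr yv]; rewrite -subt_par ?yv ?subt_refl //.
by apply/eqP=> eq; have := dep_par yr; rewrite yv eq; lia.
Qed.

Lemma parent_notin_subt v y : y \in children v -> v \notin subt y.
Proof. by move=> yv; apply/negP=> /subt_dep; rewrite (dep_child yv) ltnn. Qed.

Lemma subt_child v w : w \in subt v -> w != v -> exists2 y, y \in children v & w \in subt y.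
Proof.
rewrite inE => /andP[le /eqP iv] wv; have lt : dep v < dep w.
  rewrite ltn_neqAle le andbT; apply: contraNneq wv => eqd.
  by rewrite -iv eqd subnn.
exists (iter (dep w - (dep v).+1) par w); last by apply: subt_iter; lia.
apply/childrenP; split; first by rewrite -dep_gt0 dep_iter; lia.
by rewrite -iterS -iv; congr (iter _ par w); rewrite iv; lia.
Qed.

Lemma subt_children v : subt v = v |: \bigcup_(y in children v) subt y.
Proof.
apply/setP=> w; rewrite in_setU1; apply/idP/predU1P => [wv | [->|/bigcupP[y yv wy]]].
- case: (eqVneq w v) => [|/(subt_child wv)[y yv wy]]; [by left | right].
  by apply/bigcupP; exists y.
- exact: subt_refl.
by apply: subt_trans wy _; apply: child_subt.
Qed.

Lemma card_subt v : #|subt v| = (\sum_(y in children v) #|subt y|).+1.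
Proof.
rewrite subt_children cardsU1; have -> : v \notin \bigcup_(y in children v) subt y.
  by apply/bigcupP=> -[y /parent_notin_subt/negP].
congr _.+1; rewrite -sum1_card [\bigcup_(y in _) _]big_mkcond /=.
rewrite partition_disjoint_bigcup => [|x y xy].
  rewrite [RHS]big_mkcond; apply: eq_bigr => y _.
  by case: ifP => _; rewrite ?big_set0 // sum1_card.
apply/pred0P=> w /=; case: ifP => xv; rewrite ?in_set0 //=.
case: ifP => yv; rewrite ?in_set0 ?andbF //.
apply: contraNF xy => /andP[wx wy]; apply/eqP; apply: subt_eq wx wy _.
by rewrite (dep_child xv) (dep_child yv).
Qed.

Lemma deg_children v : deg v = #|children v| + (v != r).
Proof.
have -> : deg v = #|children v :|: [set u | (v != r) && (u == par v)]|.
  apply: eq_card => u; rewrite !inE rooted_adj orbC /= [v == _]eq_sym.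
  by case: (v != r).
rewrite cardsU; have -> : children v :&: [set u | (v != r) && (u == par v)] = set0.
  apply/setP=> u; rewrite inE [u \in set0]inE [u \in [set _ | _]]inE; apply/negP.
  case/and3P=> /dep_child du vr /eqP eu; move: du; rewrite (dep_par vr) -eu; lia.
rewrite cards0 subn0; congr (_ + _); case: (v != r) => /=.
  by rewrite -(cards1 (par v)); apply: eq_card => u; rewrite !inE.
by apply: eq_card0 => u; rewrite !inE.
Qed.

Lemma subt_exit v x y :
  adj x y -> x \in subt v -> y \notin subt v -> y = par v.
Proof.
move=> xy xv yv; have ex := subt_boundary xy xv yv; move: xy.
rewrite ex rooted_adj => /orP[/andP[_ /eqP//]|/andP[yr /eqP evy]].
by case/negP: yv; apply: child_subt; apply/childrenP.
Qed.

(** A path from [x] to [y] has to pass from [v] to [u]: it needs [dep x - dep u] steps to reach [u]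
    and at least [dep y - dep u] more. *)
Lemma dist_across u v x y :
    v \in children u -> x \in subt v -> y \notin subt v ->
  dep x + dep y <= dist x y + 2 * dep u.
Proof.
move=> uv xv yv.
(* This potential vanishes at [y], changes by at most one along every edge, the edge from [v] to [u]
   included, and takes the claimed value at [x]. *)
pose f w := if w \in subt v then dep y + dep w - 2 * dep u else dep y - dep w.
have lip a b : adj a b -> f a <= (f b).+1.
  rewrite /f => ab; have ba : adj b a by rewrite adj_sym.
  have le : dep a <= (dep b).+1 /\ dep b <= (dep a).+1.
    by move: ab; rewrite rooted_adj => /orP[] /andP[_ /eqP->]; rewrite dep_par_pred; lia.
  have dv := dep_child uv; have /childrenP[_ pv] := uv.
  case: ifP => [av|/negbT av]; case: ifP => [bv|/negbT bv]; try lia.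
    by rewrite (subt_boundary ab av bv) (subt_exit ab av bv) pv; lia.
  by rewrite (subt_boundary ba bv av) (subt_exit ba bv av) pv; lia.
have := dist_lipschitz rooted_connect lip x y.
by rewrite /f xv (negbTE yv) subnn; lia.
Qed.

(** * Weights of branches and criteria for the centroid *)

(** Every vertex of [X] climbs to [t] through parents inside [X], and the edges from the vertices
    other than [t] to their parents are pairwise distinct. *)
Lemma connected_top X t : t \in X ->
    {in X, forall w, w != t -> w != r /\ par w \in X} ->
  connected_in X /\ #|X| <= #|edges_in X|.+1.
Proof.
move=> Xt closedX; split.
  apply/andP; split; first by apply/set0Pn; exists t.
  pose e := [rel u v | [&& u \in X, v \in X & adj u v]].
  have e_sym : connect_sym e.
    by apply: sym_connect_sym => u v; rewrite /= adj_sym andbCA.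
  have to_t : {in X, forall w, connect e w t}.
    move=> w; move: {2}(dep w) (leqnn (dep w)) => k; elim: k w => [|k IHk] w le_k Xw.
      case: (eqVneq w t) => [->//|/closedX[//|wr _]].
      by case/negP: wr; apply/eqP; apply: dep0_root; lia.
    case: (eqVneq w t) => [->//|/closedX[//|wr Xp]].
    apply: connect_trans (connect1 _) (IHk _ _ Xp); first by rewrite /= Xw Xp adj_par.
    by rewrite dep_par_pred; lia.
  apply/forall_inP=> x Xx; apply/forall_inP=> y Xy.
  by apply: connect_trans (to_t x Xx) _; rewrite e_sym; apply: to_t.
rewrite (cardsD1 t X) Xt add1n ltnS -(card_in_imset (f := fun w => [set w; par w])).
  apply/subset_leq_card/subsetP=> E /imsetP[w /setD1P[wt Xw] ->].
  have [wr Xp] := closedX w Xw wt.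
  by apply/imset2P; exists w (par w); rewrite ?inE ?Xw ?Xp ?adj_par.
move=> w w' /setD1P[wt Xw] /setD1P[wt' Xw'] /= eqE.
have [[wr _] [wr' _]] := (closedX w Xw wt, closedX w' Xw' wt').
have := set21 w (par w); rewrite eqE => /set2P[//|ew].
have := set21 w' (par w'); rewrite -eqE => /set2P[//|ew'].
by have := dep_par wr; have := dep_par wr'; rewrite -ew -ew'; lia.
Qed.

(** Each edge is charged to its deeper end; a vertex [t] of minimum depth in [B] is never
    charged. *)
Lemma edges_in_leq B v : v \in B -> #|edges_in B| < #|B|.
Proof.
move=> Bv; have [t tB t_min] := @arg_minnP _ v [in B] dep Bv; have Bt : t \in B by [].
rewrite (cardsD1 t B) Bt ltnS.
apply: leq_trans (leq_imset_card (fun w => [set w; par w]) _).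
apply/subset_leq_card/subsetP=> E /imset2P[x y Bx].
rewrite inE rooted_adj => /andP[By] /orP[] /andP[nr /eqP eq] ->; apply/imsetP.
  exists x; last by rewrite eq.
  rewrite !inE Bx andbT; apply/eqP=> ext; have := t_min y By.
  by rewrite eq ext dep_par_pred; move: nr; rewrite ext -dep_gt0; lia.
exists y; last by rewrite eq setUC.
rewrite !inE By andbT; apply/eqP=> eyt; have := t_min x Bx.
by rewrite eq eyt dep_par_pred; move: nr; rewrite eyt -dep_gt0; lia.
Qed.

(** A branch at [v] contains a single neighbour [u0] of [v], so without [v] it lies in one component
    of the tree minus [v]: either [subt u0] or the complement of [subt v]. *)
Lemma weight_leq v W :
    {in children v, forall y, #|subt y| <= W} ->
    (v != r -> #|G| <= #|subt v| + W) ->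
  weight v <= W.
Proof.
move=> childW parW; apply/bigmax_leqP=> B /maxsetp /and3P[/andP[_ connB] Bv degB].
have [u0 eqN] := cards1P degB.
have inX (X : {set G}) :
    v \in X -> {in X & [predC X], forall x w, x \in B -> w \in B -> ~~ adj x w} ->
    B \subset X.
  move=> Xv noedge; apply/subsetP=> w Bw.
  pose e := [rel u w | [&& u \in B, w \in B & adj u w]].
  have e_sym : connect_sym e.
    by apply: sym_connect_sym => x y; rewrite /= adj_sym andbCA.
  have := forall_inP (forall_inP connB v Bv) w Bw => vw.
  rewrite -(closed_connect _ vw) //; apply: intro_closed => // x y /and3P[Bx By xy] Xx.
  by apply: contraLR xy => nXy; apply: noedge.
have leX (X : {set G}) : B \subset v |: X -> v \notin X -> #|X| <= W -> #|edges_in B| <= W.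
  move=> /subset_leq_card; rewrite cardsU1 => leB vX leW; rewrite vX in leB.
  by have := edges_in_leq Bv; lia.
have : u0 \in [set u in B | adj v u] by rewrite eqN inE.
rewrite inE => /andP[Bu0 vu0].
have onlyu0 w : w \in B -> adj v w -> w = u0.
  by move=> Bw vw; apply/set1P; rewrite -eqN inE Bw.
have boundary (X : {set G}) : u0 \in X ->
    (forall x w, adj x w -> x \in X -> w \notin X -> w = v) -> B \subset v |: X.
  move=> Xu0 bdX; apply: inX; first exact: setU11.
  move=> x w /setU1P[->|Xx]; rewrite !inE negb_or => /andP[wv Xw] Bx Bw.
    by apply: contraNN Xw => /(onlyu0 w Bw) ->.
  by apply: contraNN wv => /bdX -> .
move: (vu0); rewrite rooted_adj => /orP[/andP[vr /eqP eu0]|/andP[ur /eqP ev]].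
  apply: (leX (~: subt v)); last first.
  - by have := parW vr; rewrite -(cardsC (subt v)); lia.
  - by rewrite in_setC subt_refl.
  apply: boundary.
    by rewrite in_setC eu0; apply/negP=> /subt_dep; rewrite (dep_par vr) ltnn.
  move=> x w xw; rewrite !in_setC negbK => xv wv.
  by apply: (subt_boundary _ wv xv); rewrite adj_sym.
have cu0 : u0 \in children v by apply/childrenP.
apply: (leX (subt u0)); [|exact: parent_notin_subt | exact: childW].
apply: boundary; first exact: subt_refl.
move=> x w xw xu wu.
by rewrite ev; apply: subt_exit xw xu wu.
Qed.

(** [X] is connected with [v] as a pendant vertex, so it extends to a maximal such set, that is, to
    a branch at [v] with at least as many edges. *)
Lemma leq_weight X t v u0 :
    t \in X -> {in X, forall w, w != t -> w != r /\ par w \in X} ->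
    v \in X -> u0 \in X -> adj v u0 -> {in X, forall u, adj v u -> u = u0} ->
  #|X| <= (weight v).+1.
Proof.
move=> Xt closedX Xv Xu0 vu0 only; have [connX leX] := connected_top Xt closedX.
apply: leq_trans leX _; rewrite ltnS.
have [|B maxB sXB] := @maxset_exists _ [pred A : {set G} |
    [&& connected_in A, v \in A & deg_in A v == 1]] X.
  rewrite /= connX Xv; apply/cards1P; exists u0; apply/setP=> u; rewrite !inE.
  apply/andP/eqP=> [[Xu vu]|->]; [exact: only | by []].
apply: (@bigmax_sup _ B) => //; apply: subset_leq_card.
apply/subsetP=> E /imset2P[x y Xx]; rewrite inE => /andP[Xy xy] ->.
by apply/imset2P; exists x y; rewrite ?inE ?xy ?andbT // (subsetP sXB).
Qed.

Lemma weight_child u y : y \in children u -> #|subt y| <= weight u.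
Proof.
move=> uy; have /childrenP[yr yu] := uy.
rewrite -ltnS; suff: #|u |: subt y| <= (weight u).+1.
  by rewrite cardsU1 parent_notin_subt.
apply: (leq_weight (t := u) (u0 := y)); rewrite ?setU11 ?adj_child //.
- move=> w /setU1P[->|yw]; first by rewrite eqxx.
  have wr : w != r by apply: contraNneq (root_notin_subt yr) => <-.
  case: (eqVneq w y) => [->|wy] _; first by rewrite yu setU11.
  by split=> //; apply/setU1P; right; rewrite subt_par.
- by apply/setU1P; right; apply: subt_refl.
move=> w /setU1P[->|yw]; first by rewrite adj_irr.
rewrite adj_sym => /subt_boundary; apply=> //; exact: parent_notin_subt.
Qed.

Lemma weight_parent u : u != r -> #|G| <= #|subt u| + weight u.
Proof.
move=> ur; rewrite -(cardsC (subt u)) leq_add2l -ltnS.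
suff: #|u |: ~: subt u| <= (weight u).+1.
  by rewrite cardsU1 in_setC subt_refl.
apply: (leq_weight (t := r) (u0 := par u)); rewrite ?setU11 ?adj_par //.
- by apply/setU1P; right; rewrite in_setC root_notin_subt.
- move=> w /setU1P[->|] => [_|uw wr]; split=> //; apply/setU1P; right; rewrite in_setC.
    by apply/negP=> /subt_dep; rewrite (dep_par ur) ltnn.
  by rewrite subt_par -?in_setC //; apply: contraTneq uw => ->; rewrite in_setC subt_refl.
- by apply/setU1P; right; rewrite in_setC; apply/negP=> /subt_dep; rewrite (dep_par ur) ltnn.
move=> w /setU1P[->|]; rewrite ?adj_irr // in_setC rooted_adj => uw.
case/orP=> /andP[wr /eqP//] eu.
by case/negP: uw; apply: child_subt; apply/childrenP.
Qed.

(** Seen from another vertex [u], the component containing [v] consists of everything outside the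
    component of [u] seen from [v], which has at most [W] vertices. The cases are [u] below [v], [v]
    below [u], and neither. *)
Lemma weight_crit v W :
    {in children v, forall y, #|subt y| <= W} -> #|G| <= #|subt v| + W ->
  weight v <= W /\ forall u, u != v -> #|G| <= weight u + W.
Proof.
move=> childW parW; split=> [|u uv]; first exact: weight_leq.
case: (boolP (u \in subt v)) => [vu|vu].
  have [y vy yu] := subt_child vu uv.
  have ur : u != r.
    apply: contraTneq yu => ->; apply: root_notin_subt.
    by have /childrenP[] := vy.
  apply: leq_trans (weight_parent ur) _; rewrite addnC leq_add2l.
  apply: leq_trans (childW y vy); apply/subset_leq_card/subsetP=> w uw.
  exact: subt_trans uw yu.
apply: leq_trans parW _; rewrite leq_add2r.
case: (boolP (v \in subt u)) => [uv'|uv'].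
  have [|y uy yv] := subt_child uv' _; first by rewrite eq_sym.
  apply: leq_trans (weight_child uy); apply/subset_leq_card/subsetP=> w vw.
  exact: subt_trans vw yv.
have ur : u != r by apply: contraNneq uv' => ->; rewrite subt_root inE.
rewrite -(leq_add2l #|subt u|); apply: leq_trans (weight_parent ur).
rewrite -leq_subRL ?max_card // ?(leq_trans _ (max_card _)) //.
rewrite -(cardsC (subt u)) addKn; apply/subset_leq_card/subsetP=> w vw.
rewrite in_setC; apply/negP=> uw; case: (leqP (dep u) (dep v)) => le.
  by case/negP: uv'; apply: subt_comparable uw vw le.
by case/negP: vu; apply: subt_comparable vw uw (ltnW le).
Qed.

Lemma centroid_crit v :
    {in children v, forall y, 2 * #|subt y| <= #|G|} -> #|G| <= 2 * #|subt v| ->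
  v \in centroid G.
Proof.
move=> childW parW; have [||vW uW] := @weight_crit v #|G|./2.
- by move=> y /childW; lia.
- by lia.
rewrite inE; apply/forallP=> u; case: (eqVneq u v) => [->//|/uW]; lia.
Qed.

Lemma centroid_unique v :
    {in children v, forall y, 2 * #|subt y| < #|G|} -> #|G| < 2 * #|subt v| ->
  {in centroid G, forall u, u = v}.
Proof.
(* With this [W], every vertex other than [v] has weight at least [#|G| - W], which is strictly
   greater than [W]. *)
move=> childW parW u; have [||vW uW] := @weight_crit v #|G|.-1./2.
- by move=> y /childW; lia.
- by lia.
rewrite inE => /forallP /(_ v) le_uv; apply/eqP; apply: contraTT le_uv => /uW.
have leG : #|subt v| <= #|G| := max_card _.
rewrite -ltnNge; lia.
Qed.

End Rooted.

(** * Rooting a tree at an arbitrary vertex *)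

Lemma tree_connect (G : sgraph) : connected_in [set: G] -> forall x y, connect (@adj G) x y.
Proof.
case/andP=> _ connG x y; have := forall_inP (forall_inP connG x (in_setT x)) y (in_setT y).
by apply: connect_sub => u v /and3P[_ _ /connect1].
Qed.

(** A repetition-free path from [v] to [w] whose first step is not to [w] closes up, through the
    edge between them, to a cycle of length at least three. *)
Lemma acyclic_bridge (G : sgraph) (v w : G) :
    acyclic G -> adj v w ->
  ~~ connect [rel x y | adj x y && ~~ ((x == v) && (y == w))] v w.
Proof.
move=> acG vw; apply/negP=> /connectP[p0 vp0 ew].
case/shortenP: vp0 ew => p vp up _ ew.
have: ucycle (@adj G) (v :: p).
  rewrite /ucycle up andbT /= rcons_path adj_sym -ew vw andbT.
  by apply: sub_path vp => x y /andP[].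
move/acG; case: p vp up ew => [|u [|u' p]] //= vp _ ew; first by rewrite ew adj_irr in vw.
by rewrite ew !eqxx andbF in vp.
Qed.

Lemma closer_neighbour (G : sgraph) (r v : G) : connected_in [set: G] -> v != r ->
  exists2 u, adj v u & dist u r < dist v r.
Proof.
move=> /tree_connect connG vr; have [p [vp lp <-]] := dist_geodesic connG v r.
case: p vp lp => [_ /= evr|u p /= /andP[vu up] lp]; first by rewrite evr eqxx in vr.
by exists u; rewrite // ltnS -lp dist_leq_size.
Qed.

(** The parent of [v] is a neighbour closer to [r]. No other neighbour [w] is as close to [r] as [v]
    is: it would be joined to the parent, via [r], by a walk avoiding [v], and the edge from [v] to
    [w] would lie on a cycle. *)
Lemma tree_rooted (G : sgraph) (r : G) :
  is_tree G -> exists par, rooted_by r par (fun v => dist v r).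
Proof.
case=> connG acG; have cG := tree_connect connG.
pose par v := if v == r then r else odflt r [pick u | adj v u && (dist u r < dist v r)].
have parP v : v != r -> adj v (par v) /\ dist (par v) r < dist v r.
  rewrite /par => vr; rewrite (negbTE vr); case: pickP => [u /andP[]//|none].
  by have [u vu lt] := closer_neighbour connG vr; have := none u; rewrite vu lt.
have uniq_par v w : adj v w -> dist w r <= dist v r -> w = par v.
  move=> vw le; have vr : v != r.
    apply: contraTneq le => vr; rewrite -ltnNge vr distxx lt0n.
    apply: contraTneq vw => /(dist_eq0 cG) ->; by rewrite vr adj_irr.
  apply/eqP; apply: contraTT (acyclic_bridge acG vw) => neq; rewrite negbK.
  pose e := [rel x y | [&& adj x y, x != v & y != v]].
  have e_sym : connect_sym e.
    by apply: sym_connect_sym => x y; rewrite /= adj_sym [(x != v) && _]andbC.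
  (* A descent to [r] that starts at a vertex other than [v], no farther from [r] than [v], never
     meets [v], since the distance to [r] strictly decreases. *)
  have to_r x : x != v -> dist x r <= dist v r -> connect e x r.
    move: {2}(dist x r) (leqnn (dist x r)) => k; elim: k x => [|k IHk] x le_k xv le_v.
      by rewrite (dist_eq0 cG (y := r) (x := x)) //; lia.
    case: (eqVneq x r) => [->//|/parP[xp lt]].
    have pv : par x != v by apply: contraTneq lt => ->; rewrite -leqNgt.
    apply: connect_trans (connect1 _) (IHk (par x) _ pv _); [by rewrite /= xp xv | lia | lia].
  have [vp lt] := parP v vr.
  apply: (@connect_trans _ _ (par v)); first by apply: connect1; rewrite /= vp eqxx eq_sym neq.
  have sub_e : subrel (connect e) (connect [rel x y | adj x y && ~~ ((x == v) && (y == w))]).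
    apply: connect_sub => x y /and3P[xy xv _]; apply: connect1.
    by rewrite /= xy (negbTE xv).
  apply: sub_e; apply: (@connect_trans _ _ r).
    by apply: to_r; [apply: contraTneq vp => ->; rewrite adj_irr | apply: ltnW].
  by rewrite e_sym; apply: to_r => //; apply: contraTneq vw => ->; rewrite adj_irr.
exists par; split.
- by rewrite /par eqxx.
- exact: distxx.
- move=> v /parP[vp lt]; apply/eqP; rewrite eqn_leq lt andbT.
  exact: dist_step.
move=> x y; apply/idP/orP => [xy|[] /andP[nr /eqP->]].
- case: (leqP (dist y r) (dist x r)) => [le|/ltnW le].
    left; rewrite -(uniq_par _ _ xy le) eqxx andbT; apply: contraTneq le => xr.
    rewrite -ltnNge xr distxx lt0n; apply: contraTneq xy => /(dist_eq0 cG) ->.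
    by rewrite xr adj_irr.
  right; have yx : adj y x by rewrite adj_sym.
  rewrite -(uniq_par _ _ yx le) eqxx andbT; apply: contraTneq le => yr.
  rewrite -ltnNge yr distxx lt0n; apply: contraTneq yx => /(dist_eq0 cG) ->.
  by rewrite yr adj_irr.
- by have [] := parP x nr.
by rewrite adj_sym; have [] := parP y nr.
Qed.

(** * Subtrees of rooted binary trees *)

Section Subtrees.
Variables (G : sgraph) (r : G) (par : G -> G) (dep : G -> nat).
Hypothesis rootedG : rooted_by r par dep.
Implicit Types (u v w x y z : G).

Notation subt := (subt par dep).
Notation children := (children r par).

Lemma leaf_subt v : children v = set0 -> subt v = [set v].
Proof. by move=> ch0; rewrite (subt_children rootedG) ch0 big_set0 setU0. Qed.

Lemma card_subt2 v y1 y2 : y1 != y2 -> children v = [set y1; y2] ->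
  #|subt v| = (#|subt y1| + #|subt y2|).+1.
Proof.
by move=> neq ch; rewrite (card_subt rootedG) ch big_setU1 ?inE // big_set1.
Qed.

Lemma deepest_leaf v : exists w,
  [/\ w \in subt v, {in subt v, forall x, dep x <= dep w} & children w = set0].
Proof.
have [w wv max_w] := @arg_maxnP _ v [in subt v] dep (subt_refl _ _ v).
exists w; split=> //; apply/setP=> y; rewrite in_set0; apply/negP=> wy.
have yv : y \in subt v.
  by apply: (subt_trans (y := w)) => //; apply: (child_subt rootedG).
by have := max_w y yv; rewrite (dep_child rootedG wy) /= ltnn.
Qed.

Hypothesis binary : forall v, v != r -> #|children v| = 0 \/ #|children v| = 2.

Lemma children_case v : v != r -> children v = set0 \/
  exists y1 y2, y1 != y2 /\ children v = [set y1; y2].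
Proof.
case/binary=> [/eqP|/eqP/cards2P]; last by right.
by rewrite cards_eq0 => /eqP; left.
Qed.

(** With [k = h - dep v], the subtree contains a complete binary tree with [k] levels and is
    contained in one with [k + 1] levels; these have [2 ^ k - 1] and [2 ^ k.+1 - 1] vertices. A
    vertex at depth [h] makes the first inclusion strict. *)
Lemma balanced_subt (h : nat) :
    (forall v, dep v <= h) ->
    (forall v, v != r -> children v = set0 -> h.-1 <= dep v) ->
  forall v, v != r ->
    [/\ 2 ^ (h - dep v) <= #|subt v|.+1, #|subt v|.+1 <= 2 ^ (h - dep v).+1
      & forall w, w \in subt v -> dep w = h -> 2 ^ (h - dep v) <= #|subt v|].
Proof.
move=> le_h leaf_h v; move: {2}(h - dep v) (leqnn (h - dep v)) => k.
elim: k v => [|k IHk] v le_k vr; case: (children_case vr) => [ch|[y1 [y2 [neq ch]]]].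
- have -> : h - dep v = 0 by lia.
  by rewrite leaf_subt // cards1.
- have : y1 \in children v by rewrite ch set21.
  by move/(dep_child rootedG); have := le_h y1; lia.
- rewrite leaf_subt // cards1; have := leaf_h v vr ch; have := le_h v => le1 le2.
  have [-> | [-> deph]] : h - dep v = 0 \/ h - dep v = 1 /\ dep v != h by lia.
    by split.
  by split=> // w /set1P-> eqh; rewrite eqh eqxx in deph.
have [cy1 cy2] : y1 \in children v /\ y2 \in children v by rewrite ch set21 set22.
have [d1 d2] := (dep_child rootedG cy1, dep_child rootedG cy2).
have [/childrenP[r1 _] /childrenP[r2 _]] := (cy1, cy2).
have [||lo1 up1 top1] := IHk y1 => //; first by lia.
have [||lo2 up2 top2] := IHk y2 => //; first by lia.
have dk : h - dep v = (h - dep y1).+1 by have := le_h y1; lia.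
have ed : dep y2 = dep y1 by rewrite d1 d2.
rewrite (card_subt2 neq ch) dk; move: lo1 up1 lo2 up2 top1 top2; rewrite ed !expnS.
move: (2 ^ _) => q lo1 up1 lo2 up2 top1 top2; split; [by lia | by lia|].
move=> w wv wh; have wnv : w != v.
  by apply/eqP=> ewv; move: dk; rewrite -ewv wh subnn.
have [y yv yw] := subt_child rootedG wv wnv.
move: yv yw; rewrite ch => /set2P[] -> yw; first by have := top1 w yw wh; lia.
by have := top2 w yw wh; lia.
Qed.

(** Since each inner vertex has a leaf among its two children, the subtree is a path from [v] to [z]
    with one leaf hanging beside each later vertex, so every level below [v] has two vertices. The
    last clause puts all parents on this path. *)
Lemma caterpillar_subt :
    (forall v y1 y2, v != r -> y1 \in children v -> y2 \in children v ->
       y1 != y2 -> children y1 = set0 \/ children y2 = set0) ->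
  forall v, v != r -> exists z,
    [/\ z \in subt v, #|subt v| = (2 * (dep z - dep v)).+1,
        {in subt v, forall w, dep w <= dep z}
      & {in subt v, forall w, w != v -> z \in subt (par w)}].
Proof.
move=> one_leaf v; move: {2}#|subt v| (leqnn #|subt v|) => k.
elim: k v => [|k IHk] v le_k vr.
  have : 0 < #|subt v| by apply/card_gt0P; exists v; apply: subt_refl.
  by rewrite ltnNge le_k.
case: (children_case vr) => [ch|[y1 [y2 [neq ch]]]].
  exists v; rewrite leaf_subt // cards1 subnn set11; split=> // w /set1P-> //.
  by rewrite eqxx.
wlog leaf1 : y1 y2 neq ch / children y1 = set0.
  have [cy1 cy2] : y1 \in children v /\ y2 \in children v by rewrite ch set21 set22.
  case: (one_leaf _ _ _ vr cy1 cy2 neq) => leaf; first by apply; first exact: neq.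
  by apply; first (rewrite eq_sym; exact: neq); first by rewrite setUC.
have [cy1 cy2] : y1 \in children v /\ y2 \in children v by rewrite ch set21 set22.
have [d1 d2] := (dep_child rootedG cy1, dep_child rootedG cy2).
have [_ /childrenP[r2 p2]] := (cy1, cy2).
have cv := card_subt2 neq ch; rewrite (leaf_subt leaf1) cards1 in cv.
have [||z [zy cz dz pz]] := IHk y2 => //; first by lia.
have zv : z \in subt v.
  by apply: subt_trans zy _; apply: (child_subt rootedG).
have dzy := subt_dep zy.
exists z; split=> //; first by rewrite cv cz; lia.
  move=> w wv; case: (eqVneq w v) => [->|wnv]; first exact: (subt_dep zv).
  have [y] := subt_child rootedG wv wnv; rewrite ch => /set2P[]->; last exact: dz.
  by rewrite leaf_subt // => /set1P->; rewrite d1 -d2.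
move=> w wv wnv; have [y] := subt_child rootedG wv wnv; rewrite ch => /set2P[]->.
  by rewrite leaf_subt // => /set1P->; have /childrenP[_ ->] := cy1.
by move=> wy; case: (eqVneq w y2) => [->|/pz->//]; rewrite p2.
Qed.

End Subtrees.

(** * Caterpillars *)

(** The condition on [S] makes [S] without [v] a union of components of the graph minus [v], and a
    path avoiding [v] stays in one component. *)
Lemma path_avoiding (G : sgraph) (v : G) (S : {set G}) (x : G) (p : seq G) :
    (forall a b, adj a b -> a \in S -> b \notin S -> b = v) ->
    path (@adj G) x p -> v \notin x :: p ->
  {in x :: p, forall y, (y \in S) = (x \in S)}.
Proof.
move=> exitS; have sideS a b : a != v -> b != v -> adj a b -> (b \in S) = (a \in S).
  move=> av bv ab; apply/idP/idP; [apply: contraLR|apply: contraLR] => nS; apply/negP=> yS.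
    by case/eqP: av; apply: (exitS b) => //; rewrite adj_sym.
  by case/eqP: bv; apply: (exitS a).
elim: p x => [|z p IHp] x /=; first by move=> _ _ y; rewrite inE => /eqP->.
case/andP=> xz zp; rewrite inE negb_or => /andP[vx vp] y.
rewrite inE => /predU1P[->//|/IHp -> //]; apply: sideS => //; first by rewrite eq_sym.
by apply: contraNneq vp => <-; rewrite mem_head.
Qed.

(* Removing v from a path without repetition leaves at most two subpaths, so
   the path meets at most two of the components of G - v. *)
Lemma path_two_sides (G : sgraph) (v x : G) (p : seq G) :
    path (@adj G) x p -> uniq (x :: p) ->
  exists a b : G, forall S : {set G},
    v \notin S -> (forall a b, adj a b -> a \in S -> b \notin S -> b = v) ->
    {in x :: p, forall y, y \in S -> (a \in S) || (b \in S)}.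
Proof.
move=> xp ux; case: (boolP (v \in x :: p)) => [|vp]; last first.
  exists x, x => S vS exitS y py; rewrite orbb.
  by rewrite (path_avoiding exitS xp vp).
rewrite inE => /predU1P[evx|vp].
  case: p xp ux => [|z p] /=.
    by move=> _ _; exists x, x => S vS _ y /predU1P[->|//]; rewrite -evx (negbTE vS).
  case/andP=> _ zp /andP[xp _]; exists z, z => S vS exitS y.
  rewrite inE => /predU1P[->|py]; first by rewrite -evx (negbTE vS).
  by rewrite (path_avoiding exitS zp) ?orbb // evx.
case/splitPr: vp xp ux => p1 p2; rewrite cat_path -cat_cons cat_uniq.
case/and3P=> xp1 _ p2v /and3P[_ disj /andP[vp2 _]].
have vp1 : v \notin x :: p1.
  by apply: contra disj => vp1; apply/hasP; exists v; rewrite ?mem_head.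
case: p2 p2v vp2 {disj} => [|z p2] /= p2v vp2.
  exists x, x => S vS exitS y; rewrite -cat_cons mem_cat orbb => /orP[py|].
    by rewrite (path_avoiding exitS xp1).
  by rewrite inE => /eqP->; rewrite (negbTE vS).
case/andP: p2v => _ zp2; exists x, z => S vS exitS y.
rewrite -cat_cons mem_cat => /orP[py|]; first by rewrite (path_avoiding exitS xp1 vp1) // => ->.
rewrite inE => /predU1P[->|py]; first by rewrite (negbTE vS).
by rewrite (path_avoiding exitS zp2 vp2) // => ->; rewrite orbT.
Qed.

Section Caterpillar.
Variables (C : sgraph) (c : C) (par : C -> C) (dep : C -> nat).
Hypothesis rootedC : rooted_by c par dep.
Hypothesis caterpillarC : binary_caterpillar C.
Hypothesis ecc_c : forall u : C, ecc u <= ecc c.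

Notation subt := (subt par dep).
Notation children := (children c par).

Lemma deg_binary (v : C) : deg v = 1 \/ deg v = 3.
Proof.
case: caterpillarC => -[_ deg3] _.
by case: (boolP (pendant v)) => [/eqP|/deg3]; [left | right].
Qed.

Lemma caterpillar_children v : v != c -> #|children v| = 0 \/ #|children v| = 2.
Proof. by move=> vc; have := deg_binary v; rewrite (deg_children rootedC) vc; lia. Qed.

Lemma max_ecc_dist : exists z, forall x y : C, dist x y <= dep z.
Proof.
have [z _ max_z] := @arg_maxnP _ c predT dep isT; exists z => x y.
apply: leq_trans (dist_leq_ecc x y) _; apply: leq_trans (ecc_c y) _.
by apply/bigmax_leqP=> u _; rewrite (dist_root rootedC); apply: max_z.
Qed.

(** If [c] had three children, the deepest vertex [z] would lie outside the subtree of some child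
    [y], and [dist y z] would be at least [dep z + 1], against the maximality of the eccentricity of
    [c]. *)
Lemma max_ecc_pendant : #|children c| = 1.
Proof.
have := deg_binary c; rewrite (deg_children rootedC) eqxx addn0 => -[//|card3].
have [z max_z] := max_ecc_dist.
have [y cy yz] : exists2 y, y \in children c & z \notin subt y.
  have [y1 cy1] : exists y, y \in children c by apply/card_gt0P; rewrite card3.
  have [y2 /setD1P[ny cy2]] : exists y, y \in children c :\ y1.
    by apply/card_gt0P; have := cardsD1 y1 (children c); rewrite cy1 card3; lia.
  case: (boolP (z \in subt y1)) => [zy1|]; last by exists y1.
  exists y2 => //; apply: contra ny => zy2; apply/eqP; apply: (subt_eq zy2 zy1).
  by rewrite (dep_child rootedC cy1) (dep_child rootedC cy2).
have := dist_across rootedC cy (subt_refl par dep y) yz; have := max_z y z.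
by rewrite (dep_child rootedC cy) (dep_root rootedC); lia.
Qed.

(** Otherwise the subtrees of [y1] and [y2] both contain vertices two steps from [v]. Unless [par v]
    is [c], so does the side above [v], and the path of the caterpillar would have to enter three
    components of the tree minus [v]. *)
Lemma caterpillar_one_leaf v y1 y2 :
    v != c -> y1 \in children v -> y2 \in children v -> y1 != y2 ->
  children y1 = set0 \/ children y2 = set0.
Proof.
move=> vc cy1 cy2 neq.
case: (set_0Vmem (children y1)) => [|[x1 cx1]]; first by left.
case: (set_0Vmem (children y2)) => [|[x2 cx2]]; first by right.
exfalso; have [d1 d2] := (dep_child rootedC cy1, dep_child rootedC cy2).
have [dx1 dx2] := (dep_child rootedC cx1, dep_child rootedC cx2).
have [s1 s2] := (child_subt rootedC cx1, child_subt rootedC cx2).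
have dv := dep_par rootedC vc.
have [/childrenP[_ p1] /childrenP[_ p2]] := (cy1, cy2).
have disj z : z \in subt y1 -> z \in subt y2 -> False.
  by move=> z1 z2; case/eqP: neq; apply: (subt_eq z1 z2); rewrite d1 d2.
(* If [v] has depth 1, the deepest vertex [z] is separated by [v] from [x1] or [x2], both of depth
   3, and that distance exceeds [dep z]. *)
case: (eqVneq (par v) c) => [pvc|pvc].
  rewrite pvc (dep_root rootedC) in dv; have [z max_z] := max_ecc_dist.
  case: (boolP (z \in subt y1)) => [z1|z1].
    have n2 : x2 \notin subt y1 by apply/negP=> n1; apply: disj n1 s2.
    by have := dist_across rootedC cy1 z1 n2; have := max_z z x2; lia.
  by have := dist_across rootedC cy1 s1 z1; have := max_z x1 z; lia.
have [_ [x [p [xp ux cover]]]] := caterpillarC.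
have [a [b sides]] := path_two_sides v xp ux.
(* A vertex [t] of [S] not adjacent to [v] is on the path or next to a path vertex, which then also
   lies in [S]; so the path meets [S]. *)
have meets (S : {set C}) t : t \in S -> v \notin S ->
    (forall u w, adj u w -> u \in S -> w \notin S -> w = v) -> ~~ adj t v ->
    (a \in S) || (b \in S).
  move=> tS vS exitS tv; case: (boolP (t \in x :: p)) => [tp|/cover[u up tu]].
    exact: (sides S vS exitS t).
  apply: (sides S vS exitS u) => //; apply: contraTT tu => uS.
  by apply: contraNN tv => tu; rewrite -(exitS _ _ tu tS uS).
have meets_child y t : y \in children v -> t \in children y -> (a \in subt y) || (b \in subt y).
  move=> cy ct; have /childrenP[_ py] := cy.
  apply: (meets _ t (child_subt rootedC ct)); first exact: (parent_notin_subt rootedC cy).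
    by move=> u w uw uS wS; rewrite -py; apply: (subt_exit rootedC uw).
  apply/negP=> tv; have := dep_child rootedC ct.
  have -> := subt_boundary rootedC tv (child_subt rootedC ct) (parent_notin_subt rootedC cy).
  exact: n_Sn.
have meets_up : (a \in ~: subt v) || (b \in ~: subt v).
  apply: (meets _ (par (par v))).
  - rewrite in_setC; apply/negP=> /subt_dep.
    by rewrite dv (dep_par rootedC pvc) ltnNge leqnSn.
  - by rewrite in_setC negbK subt_refl.
  - move=> u w uw; rewrite !in_setC negbK => uS wS.
    by apply: (subt_boundary rootedC _ wS uS); rewrite adj_sym.
  rewrite adj_sym; apply/negP=> vpp.
  have pp : par (par v) = par v.
    apply: (subt_exit rootedC vpp (subt_refl _ _ v)); apply/negP=> /subt_dep.
    by rewrite dv (dep_par rootedC pvc) ltnNge leqnSn.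
  by have := dep_par rootedC pvc; rewrite pp => /n_Sn.
have up_disj z y : y \in children v -> z \in subt y -> z \in ~: subt v -> False.
  by move=> cy zy; rewrite in_setC => /negP[]; apply: subt_trans zy (child_subt rootedC cy).
(* Pigeonhole: [a] and [b] cannot meet three pairwise disjoint sets. *)
move: (meets_child _ _ cy1 cx1) (meets_child _ _ cy2 cx2) meets_up.
move=> /orP[m1|m1] /orP[m2|m2] /orP[m3|m3]; by
  [apply: disj m1 m2 | apply: up_disj cy1 m1 m3 | apply: up_disj cy2 m2 m3].
Qed.

End Caterpillar.

(** * The shape of a crg tree *)

Lemma rooted_iso (G K : sgraph) (f : G -> K) (g : K -> G) r par dep :
    cancel f g -> cancel g f -> (forall x y, adj (f x) (f y) = adj x y) ->
    rooted_by r par dep ->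
  rooted_by (g r) (fun x => g (par (f x))) (fun x => dep (f x)).
Proof.
move=> fK gK adjf rootedK; have eq_g x y : (x == g y) = (f x == y).
  by rewrite -(can_eq fK) gK.
split=> [||v|x y].
- by rewrite gK (par_root rootedK).
- by rewrite gK (dep_root rootedK).
- by rewrite gK eq_g; apply: (dep_par rootedK).
by rewrite -adjf (rooted_adj rootedK) !eq_g.
Qed.

Section Identify.
Variables (R C : sgraph) (r : R) (c : C).
Variables (parR : R -> R) (depR : R -> nat) (parC : C -> C) (depC : C -> nat).
Hypothesis rootedR : rooted_by r parR depR.
Hypothesis rootedC : rooted_by c parC depC.

Notation K := (identify r c).

(** The embedding of all of [C] in the identified graph; [c] goes to the merged vertex [inl r]. *)
Definition identify_inr (u : C) : K := if insub u is Some s then inr s else inl r.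

Lemma identify_inr_root : identify_inr c = inl r.
Proof. by rewrite /identify_inr insubF // eqxx. Qed.

Lemma identify_inr_val (s : {v : C | v != c}) : identify_inr (val s) = inr s.
Proof. by rewrite /identify_inr valK. Qed.

Variant identify_inr_spec (u : C) : K -> Type :=
  | IdentifyRoot of u = c : identify_inr_spec u (inl r)
  | IdentifyInr s of u != c & u = val s : identify_inr_spec u (inr s).

Lemma identify_inrP u : identify_inr_spec u (identify_inr u).
Proof.
rewrite /identify_inr; case: insubP => [s us <-|]; first by apply: IdentifyInr; rewrite ?(valP s).
by rewrite negbK => /eqP; apply: IdentifyRoot.
Qed.

Definition identify_par (t : K) : K :=
  match t with inl x => inl (parR x) | inr s => identify_inr (parC (val s)) end.

Definition identify_dep (t : K) : nat :=
  match t with inl x => depR x | inr s => depC (val s) end.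

Lemma identify_par_inr u :
  identify_par (identify_inr u) = identify_inr (parC u).
Proof.
case: identify_inrP => [->|s _ ->] //=.
by rewrite (par_root rootedR) (par_root rootedC) identify_inr_root.
Qed.

Lemma identify_dep_inr u : identify_dep (identify_inr u) = depC u.
Proof.
by case: identify_inrP => [->|s _ ->] //=; rewrite (dep_root rootedR) (dep_root rootedC).
Qed.

Lemma identify_inr_inj : injective identify_inr.
Proof.
move=> u v; case: identify_inrP => [->|s _ ->]; case: identify_inrP => [->|s' _ ->] //.
by case=> ->.
Qed.

Lemma rooted_identify : rooted_by (inl r : K) identify_par identify_dep.
Proof.
have inlE x y : ((inl x : K) == inl y) = (x == y) by [].
have nc (s : {v : C | v != c}) : (sval s == c) = false by apply/negbTE; exact: (valP s).
have inrE x y : ((inr x : K) == inr y) = (val x == val y) by [].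
split=> [||[x|s]|[x|s] [y|s']] /=.
- by rewrite (par_root rootedR).
- exact: (dep_root rootedR).
- by rewrite inlE; apply: (dep_par rootedR).
- by move=> _; rewrite identify_dep_inr; apply: (dep_par rootedC); apply: valP s.
- by rewrite !inlE; apply: (rooted_adj rootedR).
- rewrite (rooted_adj rootedC) eqxx /= (valP s') andbF /=.
  case: identify_inrP => [->|s us eqs]; first by rewrite eqxx andbT inlE.
  by rewrite [c == _]eq_sym (negbTE us) !andbF.
- rewrite (rooted_adj rootedC) eqxx /= (valP s) andbF orbF /=.
  case: identify_inrP => [->|s' us eqs]; first by rewrite eqxx andbT inlE.
  by rewrite [c == _]eq_sym (negbTE us) !andbF.
rewrite (rooted_adj rootedC) (valP s) (valP s') /=.
by congr (_ || _); case: identify_inrP => [->|s1 us ->]; rewrite ?inrE //;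
  rewrite nc.
Qed.

End Identify.

Section Embedding.
Variables (H G : sgraph) (e : H -> G).
Variables (parH : H -> H) (depH : H -> nat) (parG : G -> G) (depG : G -> nat).
Hypothesis e_inj : injective e.
Hypothesis e_par : forall x, parG (e x) = e (parH x).
Hypothesis e_dep : forall x, depG (e x) = depH x.

Lemma embed_iter k x : iter k parG (e x) = e (iter k parH x).
Proof. by elim: k => //= k ->. Qed.

(** An injection that commutes with parents and depths preserves ancestry. The hypothesis keeps the
    subtree inside the image; in the crg tree it holds away from the merged root. *)
Lemma embed_subt y :
    (forall w, w \in subt parG depG (e y) -> exists x, w = e x) ->
  subt parG depG (e y) = e @: subt parH depH y.
Proof.
have emb x : (e x \in subt parG depG (e y)) = (x \in subt parH depH y).
  by rewrite !inE !e_dep embed_iter (inj_eq e_inj).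
move=> img; apply/setP=> w; apply/idP/imsetP => [wy|[x xy ->]]; last by rewrite emb.
by have [x ex] := img w wy; exists x; rewrite // -emb -ex.
Qed.

End Embedding.

(** [r] is the merged vertex, [q] its child in the caterpillar, [a] and [b] its children in the
    rgood tree of height [h], and [z] a deepest vertex of the caterpillar, at depth [D]. The
    caterpillar has [2 * D] vertices, [r] included. *)
Record crg_shape (n m : nat) (G : sgraph) (r : G) (par : G -> G) (dep : G -> nat)
    (q a b z : G) (h D : nat) : Prop := CrgShape {
  crg_rooted : rooted_by r par dep;
  crg_neq : [&& q != a, q != b & a != b];
  crg_children : children r par r = [set q; a; b];
  crg_card : #|G| = n;
  crg_card_rgood : (#|subt par dep a| + #|subt par dep b|).+1 = m;
  crg_length : n.+1 = m + 2 * D;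
  crg_card_spine : #|subt par dep q|.+1 = 2 * D;
  crg_end : z \in subt par dep q /\ dep z = D;
  crg_spine : {in subt par dep q, forall v, exists y,
    [/\ y \in subt par dep v, #|subt par dep v| = (2 * (dep y - dep v)).+1
      & {in subt par dep v, forall w, dep w <= dep y}]};
  crg_near_spine : {in subt par dep q, forall w, w != q -> z \in subt par dep (par w)};
  crg_height : forall w, w \notin subt par dep q -> dep w <= h;
  crg_balanced : forall v, v \notin subt par dep q -> v != r ->
    [/\ 2 ^ (h - dep v) <= #|subt par dep v|.+1,
        #|subt par dep v|.+1 <= 2 ^ (h - dep v).+1
      & forall w, w \in subt par dep v -> dep w = h ->
          2 ^ (h - dep v) <= #|subt par dep v|];
  crg_deep : {in [set a; b], forall v,
    exists2 w, w \in subt par dep v & h.-1 <= dep w};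
  crg_top : exists2 w, w \in subt par dep a :|: subt par dep b & dep w = h
}.

Lemma is_crg_shape n m (G : sgraph) : is_crg n m G ->
  exists (r : G) par dep q a b z h D, crg_shape n m r par dep q a b z h D.
Proof.
case=> [[n_even n_ge4 m_odd /andP[m_ge3 lt_mn]]].
case=> R [C [r [c [[[rbt leafR _] cardR] [catC cardC] ecc_c [f [g fK gK] adjf]]]]].
have [treeR [cardR1|[degr degR]]] := rbt; first by lia.
have [[treeC _] _] := catC.
have [parR rootedR] := tree_rooted r treeR.
have [parC rootedC] := tree_rooted c treeC.
set depR := fun v => dist v r in rootedR; set depC := fun v => dist v c in rootedC.
have binR v : v != r -> #|children r parR v| = 0 \/ #|children r parR v| = 2.
  by move=> vr; have := degR v vr; rewrite (deg_children rootedR) vr; lia.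
have binC := caterpillar_children rootedC catC.
have spineC := caterpillar_subt rootedC binC (caterpillar_one_leaf rootedC catC ecc_c).
have /cards1P[qC childC] : #|children c parC c| == 1.
  by rewrite (max_ecc_pendant rootedC catC ecc_c).
have /cards2P[aR [bR [nab childR]]] : #|children r parR r| == 2.
  by move: degr; rewrite (deg_children rootedR) eqxx addn0 => ->.
have [top [_ max_top leaf_top]] := deepest_leaf rootedR r.
have {}max_top v : depR v <= depR top.
  by apply: max_top; apply: mem_subt_root.
have top_r : top != r.
  apply/eqP=> etop; have := set21 aR bR.
  by rewrite -childR -[X in children _ _ X]etop leaf_top inE.
have pend v : v != r -> children r parR v = set0 -> pendant v.
  by move=> vr ch; rewrite /pendant (deg_children rootedR) ch cards0 vr.
have leaf_dep v : v != r -> children r parR v = set0 -> (depR top).-1 <= depR v.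
  move=> vr ch; have := leafR _ _ (pend top top_r leaf_top) (pend v vr ch).
  by rewrite /height -/(depR top) -/(depR v); lia.
have balR := balanced_subt rootedR binR max_top leaf_dep.
pose K := identify r c.
have rootedK := rooted_identify rootedR rootedC.
have := rooted_iso fK gK adjf rootedK.
set rG := g _; set par := (fun x => _); set dep := (fun x => _) => rootedG.
(* [i] and [j] embed the rgood tree and the caterpillar in [G]; their images cover [G] and meet only
   in the root. *)
pose i x := g (inl x : K); pose j u := g (identify_inr r c u).
have g_inj := can_inj gK.
have i_inj : injective i by move=> x y /g_inj[].
have j_inj : injective j by move=> x y /g_inj/identify_inr_inj.
have i_par x : par (i x) = i (parR x) by rewrite /par /i gK.
have j_par x : par (j x) = j (parC x).
  by rewrite /par /j gK (identify_par_inr rootedR rootedC).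
have i_dep x : dep (i x) = depR x by rewrite /dep /i gK.
have j_dep x : dep (j x) = depC x.
  by rewrite /dep /j gK (identify_dep_inr rootedR rootedC).
have j_root : j c = rG by rewrite /j identify_inr_root.
have ij x u : i x = j u -> x = r /\ u = c.
  by move/g_inj; case: identify_inrP => [-> [->]|].
have cover t : (exists x, t = i x) \/ exists2 u, u != c & t = j u.
  rewrite -(fK t); case: (f t) => [x|s]; [by left; exists x | right].
  by exists (val s); [exact: (valP s) | rewrite /j identify_inr_val].
have subt_i y : y != r -> subt par dep (i y) = i @: subt parR depR y.
  move=> yr; apply: (embed_subt i_inj i_par i_dep) => w.
  case: (cover w) => [//|[u uc ->]]; rewrite inE => /andP[_ /eqP].
  by rewrite (embed_iter j_par) => /esym/ij[eyr]; rewrite eyr eqxx in yr.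
have subt_j u : u != c -> subt par dep (j u) = j @: subt parC depC u.
  move=> uc; apply: (embed_subt j_inj j_par j_dep) => w.
  case: (cover w) => [[x ->]|[v _ ->]]; last by exists v.
  rewrite inE => /andP[_ /eqP]; rewrite (embed_iter i_par) => /ij[_ euc].
  by rewrite euc eqxx in uc.
have [cq ca cb] : [/\ qC \in children c parC c, aR \in children r parR r
    & bR \in children r parR r] by rewrite childC childR set11 set21 set22.
have [[/childrenP[qc pq] /childrenP[ar pa]] /childrenP[br pb]] := ((cq, ca), cb).
have [z [zq cardq maxz nearz]] := spineC qC qc.
have dq : depC qC = 1 by rewrite (dep_child rootedC cq) (dep_root rootedC).
have dz : 0 < depC z by have := subt_dep zq; rewrite dq.
have cardC' : #|C| = #|subt parC depC qC|.+1.
  by rewrite -cardsT -(subt_root rootedC) (card_subt rootedC) childC big_set1.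
have cardR' : #|R| = (#|subt parR depR aR| + #|subt parR depR bR|).+1.
  by rewrite -cardsT -(subt_root rootedR) (card_subt2 rootedR nab childR).
have notin_spine t : t \notin subt par dep (j qC) -> exists x, t = i x.
  rewrite subt_j // => tq; case: (cover t) => [//|[u uc et]].
  case/negP: tq; rewrite et; apply: imset_f.
  have [y] := subt_child rootedC (mem_subt_root rootedC u) uc.
  by rewrite childC => /set1P->.
have i_notin x : i x \notin subt par dep (j qC).
  by rewrite subt_j //; apply/imsetP=> -[u uq /ij[_ euc]];
     have := root_notin_subt rootedC qc; rewrite -euc uq.
have neqs : [&& j qC != i aR, j qC != i bR & i aR != i bR].
  rewrite (inj_eq i_inj) nab andbT.
  by apply/andP; split; apply/eqP=> /esym/ij[_ euc]; rewrite euc eqxx in qc.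
have childG : children rG par rG = [set j qC; i aR; i bR].
  apply/setP=> t; rewrite !in_setU !in_set1; case: (cover t) => [[x ->]|[u uc ->]].
    rewrite [_ \in children _ _ _]inE i_par -[rG]/(i r) !(inj_eq i_inj).
    have -> : (i x == j qC) = false by apply/eqP=> /ij[_ euc]; rewrite euc eqxx in qc.
    rewrite orFb; have /setP/(_ x) := childR; rewrite !inE => <- //.
  rewrite [_ \in children _ _ _]inE j_par -j_root !(inj_eq j_inj).
  have nj y : (j u == i y) = false by apply/eqP=> /esym/ij[_ euc]; rewrite euc eqxx in uc.
  by rewrite !nj !orbF; have /setP/(_ u) := childC; rewrite !inE.
have cardG : #|G| = n.
  have := card_subt rootedG rG; rewrite (subt_root rootedG) cardsT => ->.
  case/and3P: neqs => nqa nqb nab'.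
  rewrite childG setUC big_setU1 ?inE ?negb_or ?[i bR == _]eq_sym ?nqb ?nab' //.
  rewrite big_setU1 ?inE // big_set1 !subt_i // subt_j // !card_imset //.
  move: cardR cardC lt_mn; rewrite cardR' cardC'; clear; rewrite /=; lia.
exists rG, par, dep, (j qC), (i aR), (i bR), (j z), (depR top), (depC z).
split=> //.
- by rewrite !subt_i // !card_imset // -cardR' cardR.
- by move: cardC dz lt_mn; rewrite cardC' cardq dq; clear; lia.
- by rewrite subt_j // card_imset // cardq dq; move: dz; clear; lia.
- by rewrite subt_j // imset_f // j_dep.
- move=> v; rewrite subt_j // => /imsetP[u uq ->].
  have uc : u != c.
    by apply: contraTneq uq => ->; apply: root_notin_subt.
  have [y [yu cu maxy _]] := spineC u uc; exists (j y).
  rewrite subt_j // imset_f // card_imset // !j_dep cu; split=> // w /imsetP[u' u'u ->].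
  by rewrite j_dep; apply: maxy.
- move=> w; rewrite subt_j // => /imsetP[u uq ->] ujq.
  have uqn : u != qC by apply: contraNneq ujq => ->.
  have pc : parC u != c.
    apply: contraTneq (nearz u uq uqn) => epc; apply/negP=> _.
    have uch : u \in children c parC c.
      by apply/childrenP; split=> //; apply: contraTneq uq => ->; apply: root_notin_subt.
    by move: uch; rewrite childC inE (negbTE uqn).
  by rewrite j_par subt_j // imset_f // nearz.
- by move=> w /notin_spine[x ->]; rewrite i_dep.
- move=> v /notin_spine[x ->] xr; have xr' : x != r by apply: contraNneq xr => ->.
  have [lo up hi] := balR x xr'; rewrite subt_i // card_imset // i_dep; split=> //.
  by move=> w /imsetP[y yx ->]; rewrite i_dep; apply: hi.
- have deep y : y != r -> exists2 w, w \in subt par dep (i y) & (depR top).-1 <= dep w.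
    move=> yr; have [w [wy _ leaf_w]] := deepest_leaf rootedR y.
    exists (i w); rewrite ?subt_i ?imset_f // i_dep leaf_dep //.
    by apply: contraTneq wy => ->; apply: root_notin_subt.
  by move=> v /set2P[]->; apply: deep.
exists (i top); rewrite ?i_dep // !subt_i // in_setU.
have [y] := subt_child rootedR (mem_subt_root rootedR top) top_r.
by rewrite childR => /set2P[]-> ty; rewrite !(mem_imset _ _ i_inj) ty ?orbT.
Qed.

(** * Center and centroid of a crg tree *)

Lemma crg_shape_swap n m (G : sgraph) (r : G) par dep q a b z h D :
  crg_shape n m r par dep q a b z h D -> crg_shape n m r par dep q b a z h D.
Proof.
case=> ? /and3P[qa qb ab] ch ? ca ? ? ? ? ? ? ? deep top; split=> //.
- by rewrite qb qa eq_sym.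
- by rewrite ch -!setUA [[set a; b]]setUC.
- by rewrite addnC.
- by move=> v vba; apply: deep; rewrite setUC.
by rewrite setUC.
Qed.

Section Shape.
Variables (n m : nat) (G : sgraph) (r : G) (par : G -> G) (dep : G -> nat).
Variables (q a b z : G) (h D : nat).
Hypothesis shape : crg_shape n m r par dep q a b z h D.

Notation subt := (subt par dep).
Notation children := (children r par).

Let rootedG := crg_rooted shape.
Let connG := rooted_connect rootedG.

Lemma crg_child_q : q \in children r.
Proof. by rewrite (crg_children shape) !inE eqxx. Qed.

Lemma crg_child_a : a \in children r.
Proof. by rewrite (crg_children shape) !inE eqxx orbT. Qed.

Lemma crg_child_b : b \in children r.
Proof. by rewrite (crg_children shape) !inE eqxx !orbT. Qed.

Lemma crg_dep1 v : v \in children r -> dep v = 1.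
Proof. by move/(dep_child rootedG)->; rewrite (dep_root rootedG). Qed.

Lemma crg_children_disjoint u v w :
  u \in children r -> v \in children r -> u != v -> w \in subt u -> w \notin subt v.
Proof.
move=> cu cv uv wu; apply: contra uv => wv; apply/eqP; apply: (subt_eq wu wv).
by rewrite !crg_dep1.
Qed.

Lemma crg_length_gt0 : 0 < D.
Proof. by have [/subt_dep + <-] := crg_end shape; rewrite (crg_dep1 crg_child_q). Qed.

Lemma crg_dep_spine : {in subt q, forall v, dep v <= D}.
Proof.
move=> v vq; have [y [yq cq maxy]] := crg_spine shape (subt_refl par dep q).
apply: leq_trans (maxy v vq) _; have := crg_card_spine shape.
have := subt_dep yq; rewrite cq (crg_dep1 crg_child_q); clear; lia.
Qed.

Lemma crg_card_spine_leq v : v \in subt q -> #|subt v| <= (2 * (D - dep v)).+1.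
Proof.
move=> vq; have [y [yv -> _]] := crg_spine shape vq.
by rewrite ltnS leq_mul2l leq_sub2r //; apply: crg_dep_spine; apply: subt_trans yv vq.
Qed.

(** The vertex at depth [i] on the path from [r] to [z], for [i <= D]. *)
Definition spine i : G := iter (D - i) par z.

Lemma dep_spine i : i <= D -> dep (spine i) = i.
Proof. by move=> le; rewrite (dep_iter rootedG) (crg_end shape).2 subKn. Qed.

Lemma end_spine i : z \in subt (spine i).
Proof. by apply: (subt_iter rootedG); rewrite (crg_end shape).2 leq_subr. Qed.

Lemma spine0 : spine 0 = r.
Proof. by apply: (dep0_root rootedG); rewrite dep_spine. Qed.

Lemma spine_subt i j : i <= j <= D -> spine j \in subt (spine i).
Proof.
case/andP=> ij jD; apply: subt_comparable (end_spine i) (end_spine j) _.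
by rewrite !dep_spine // (leq_trans ij).
Qed.

Lemma spine_q i : 0 < i <= D -> spine i \in subt q.
Proof.
case/andP=> i0 iD; apply: subt_comparable (crg_end shape).1 (end_spine i) _.
by rewrite dep_spine // (crg_dep1 crg_child_q).
Qed.

Lemma dist_spine i j : i <= j <= D -> dist (spine j) (spine i) <= j - i.
Proof.
move=> ij; apply: leq_trans (dist_subt rootedG (spine_subt ij)) _.
by case/andP: ij => ij jD; rewrite !dep_spine // (leq_trans ij).
Qed.

Lemma card_spine i : 0 < i <= D -> #|subt (spine i)| = (2 * (D - i)).+1.
Proof.
move=> iD; have [y [yi -> maxy]] := crg_spine shape (spine_q iD).
have le_y := crg_dep_spine (subt_trans yi (spine_q iD)).
have := maxy z (end_spine i); rewrite (crg_end shape).2 => ge_y.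
have -> : dep y = D by apply/eqP; rewrite eqn_leq le_y.
by rewrite dep_spine //; case/andP: iD.
Qed.

(** Vertices outside [subt q] are reached through [r] in at most [h + i] steps, those below
    [spine i] in at most [D - i]; the others branch off above [spine i] and are within [i]. *)
Lemma dist_spine_leq i v : i <= D -> dist v (spine i) <= maxn (h + i) (D - i).
Proof.
move=> iD; case: (boolP (v \in subt q)) => [vq|vq]; last first.
  rewrite leq_max; apply/orP; left.
  apply: leq_trans (dist_triangle connG r v (spine i)) _; rewrite leq_add //.
    by rewrite (dist_root rootedG); exact: (crg_height shape vq).
  by rewrite (dist_sym connG) (dist_root rootedG) dep_spine.
case: (boolP (v \in subt (spine i))) => [vi|vi].
  rewrite leq_max; apply/orP; right; apply: leq_trans (dist_subt rootedG vi) _.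
  by rewrite dep_spine // leq_sub2r // crg_dep_spine.
have i0 : 0 < i by rewrite lt0n; apply: contraNneq vi => ->; rewrite spine0 mem_subt_root.
have iq := spine_q (introT andP (conj i0 iD)).
rewrite leq_max; apply/orP; left; apply: leq_trans (leq_addl h i).
case: (eqVneq v q) => [->|vnq].
  rewrite (dist_sym connG); apply: leq_trans (dist_subt rootedG iq) _.
  by rewrite dep_spine // leq_subr.
(* The parent of [v] is on the path to [z], at a depth from 1 to [i - 1], so [v] is at most
   [1 + (i - 1)] steps from [spine i]. *)
have zp := crg_near_spine shape vq vnq.
have vr : v != r.
  by apply: contraTneq vq => ->; apply: (root_notin_subt rootedG); case/childrenP: crg_child_q.
have pq : par v \in subt q by rewrite (subt_par rootedG).
have dp : 0 < dep (par v) by rewrite -(crg_dep1 crg_child_q); apply: subt_dep pq.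
have lt_i : dep (par v) < i.
  rewrite ltnNge; apply: contra vi => le_i.
  have vp : v \in subt (par v) by apply: (child_subt rootedG); apply/childrenP.
  apply: subt_trans vp _; apply: subt_comparable (end_spine i) zp _.
  by rewrite dep_spine.
have ip : spine i \in subt (par v).
  by apply: subt_comparable zp (end_spine i) _; rewrite dep_spine // ltnW.
apply: leq_trans (dist_triangle connG (par v) v (spine i)) _.
have := dist_subt rootedG ip; rewrite dep_spine // (dist_sym connG) => le2.
have := dist_adj (adj_par rootedG vr) => le1.
apply: leq_trans (leq_add le1 le2) _; move: dp lt_i; clear; lia.
Qed.

Lemma crg_far : exists w, D + h <= dist z w.
Proof.
have [w wab dw] := crg_top shape; exists w; have [zq dz] := crg_end shape.
case/and3P: (crg_neq shape) => qa qb _.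
have wq : w \notin subt q.
  case/setUP: wab => wab; apply: crg_children_disjoint wab;
  by rewrite ?crg_child_q ?crg_child_a ?crg_child_b // eq_sym.
by have := dist_across rootedG crg_child_q zq wq; rewrite dz dw (dep_root rootedG) addn0.
Qed.

Lemma crg_far_rgood : exists w u : G, 2 * h <= (dist w u).+1.
Proof.
have [w wab dw] := crg_top shape; case/and3P: (crg_neq shape) => _ _ ab.
case/setUP: wab => wv.
  have [u ub du] := crg_deep shape (set22 a b).
  have ua : u \notin subt a.
    by apply: crg_children_disjoint ub; rewrite ?crg_child_a ?crg_child_b // eq_sym.
  exists w, u; have := dist_across rootedG crg_child_a wv ua.
  rewrite dw (dep_root rootedG); move: du; clear; lia.
have [u ua du] := crg_deep shape (set21 a b).
have ub : u \notin subt b.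
  by apply: crg_children_disjoint ua; rewrite ?crg_child_a ?crg_child_b.
exists w, u; have := dist_across rootedG crg_child_b wv ub.
rewrite dw (dep_root rootedG); move: du; clear; lia.
Qed.

(** * Central vertices *)

Lemma spine_center : h <= D -> spine (D - h)./2 \in center G.
Proof.
move=> hD; have [w far] := crg_far; have le_i : (D - h)./2 <= D by clear -hD; lia.
(* The radius [e] is [(D + h) / 2] rounded up, so [2 * e] exceeds [D + h], a lower bound for
   [dist z w], by at most one. *)
apply: (center_crit connG (z := z) (w := w) (e := D - (D - h)./2)) => [u|].
  apply: leq_trans (dist_spine_leq u le_i) _; rewrite geq_max leqnn andbT.
  by clear -hD; lia.
by move: far; clear -hD; lia.
Qed.

Lemma dist_root_leq v : D <= h -> dist v r <= h.
Proof.
move=> Dh; rewrite (dist_root rootedG); case: (boolP (v \in subt q)) => [vq|].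
  by apply: leq_trans Dh; apply: crg_dep_spine.
exact: (crg_height shape).
Qed.

Lemma root_center : D <= h -> r \in center G.
Proof.
move=> Dh; have [w [u far]] := crg_far_rgood.
by apply: (center_crit connG _ far) => v; apply: dist_root_leq.
Qed.

(** For [h <= D], a central vertex lies within [D - (D - h)./2] of [z], because [spine (D - h)./2]
    has at most this eccentricity, while [z] has depth [D]. *)
Lemma center_dist_root x : x \in center G -> (D - h)./2 <= dist x r.
Proof.
move=> xC; case: (leqP D h) => [Dh|/ltnW hD].
  by rewrite (eqP (_ : D - h == 0)).
have le_i : (D - h)./2 <= D by clear -hD; lia.
have ecc_x := center_ecc xC (fun v => dist_spine_leq v le_i).
have := dist_triangle connG x z r; rewrite (dist_root rootedG) (crg_end shape).2.
by move: (ecc_x z) hD; clear; lia.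
Qed.

(** * Vertices of the centroid *)

Lemma root_centroid :
  2 * #|subt q| <= n -> 2 * #|subt a| <= n -> 2 * #|subt b| <= n -> r \in centroid G.
Proof.
move=> leq_q leq_a leq_b; apply: (centroid_crit rootedG); rewrite ?(crg_card shape).
  by move=> y; rewrite (crg_children shape) !inE => /orP[/orP[]|] /eqP->.
by rewrite (subt_root rootedG) cardsT (crg_card shape) leq_pmull.
Qed.

Lemma root_centroid_unique :
    2 * #|subt q| < n -> 2 * #|subt a| < n -> 2 * #|subt b| < n ->
  {in centroid G, forall y, y = r}.
Proof.
move=> lt_q lt_a lt_b; apply: (centroid_unique rootedG); rewrite ?(crg_card shape).
  by move=> y; rewrite (crg_children shape) !inE => /orP[/orP[]|] /eqP->.
rewrite (subt_root rootedG) cardsT (crg_card shape).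
by move: lt_q; clear; lia.
Qed.

(** The subtree of [spine i] has [2 * (D - i) + 1] vertices and that of a child at most
    [2 * (D - i) - 1]; the two inequalities compare these numbers with [n / 2]. *)
Lemma spine_centroid i : 0 < i <= D ->
  4 * (D - i) <= n.+2 -> n <= 4 * (D - i) + 2 -> spine i \in centroid G.
Proof.
move=> iD lo up; apply: (centroid_crit rootedG); rewrite ?(crg_card shape).
  move=> y cy; have dy := dep_child rootedG cy; rewrite dep_spine in dy; last by case/andP: iD.
  have yq : y \in subt q.
    exact: subt_trans (child_subt rootedG cy) (spine_q iD).
  have := crg_card_spine_leq yq; have := crg_dep_spine yq; rewrite dy.
  by move: lo; clear; lia.
by rewrite card_spine //; move: up; clear; lia.
Qed.

(** * Size and height of the rgood tree *)

Lemma crg_bound v : v \in [set a; b] ->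
  [/\ 2 ^ h.-1 <= #|subt v|.+1, #|subt v|.+1 <= 2 ^ h
    & forall w, w \in subt v -> dep w = h -> 2 ^ h.-1 <= #|subt v|].
Proof.
move=> vab; have cv : v \in children r.
  by move: vab; rewrite (crg_children shape) !inE => /orP[] ->; rewrite ?orbT.
have vr : v != r by case/childrenP: cv.
have vq : v \notin subt q.
  apply: (crg_children_disjoint cv crg_child_q) (subt_refl _ _ v).
  case/and3P: (crg_neq shape) => qa qb _.
  by case/set2P: vab => ->; rewrite eq_sym.
have := crg_balanced shape vq vr; rewrite (crg_dep1 cv) subn1.
have := crg_height shape vq; rewrite (crg_dep1 cv) => h0.
by rewrite prednK.
Qed.

Lemma crg_height_gt0 : 0 < h.
Proof.
have [w wab <-] := crg_top shape.
suff: 1 <= dep w by [].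
by case/setUP: wab => /subt_dep; rewrite crg_dep1 ?crg_child_a ?crg_child_b.
Qed.

(** Adding the bounds for [a] and [b] and counting [r] gives [2 ^ h - 1 <= m <= 2 ^ h.+1 - 1]; the
    vertex at depth [h] raises the lower bound by one. *)
Lemma crg_height_bounds : 2 ^ h <= m < 2 ^ h.+1.
Proof.
have [[loa upa topa] [lob upb topb]] := (crg_bound (set21 a b), crg_bound (set22 a b)).
have [w wab dw] := crg_top shape; have := crg_card_rgood shape.
have -> : 2 ^ h = 2 * 2 ^ h.-1 by rewrite -expnS prednK // crg_height_gt0.
rewrite expnS -(prednK crg_height_gt0) expnS /= in upa upb *.
by case/setUP: wab => wv; [have := topa w wv dw | have := topb w wv dw];
  move: loa upa lob upb; clear; lia.
Qed.

(** A child of [a] has depth 2, so its subtree has at most [2 ^ h.-1 - 1] vertices, less than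
    [n / 2] since [2 ^ h <= m < n]. *)
Lemma child_centroid : n <= 2 * #|subt a| -> a \in centroid G.
Proof.
move=> le_n; apply: (centroid_crit rootedG); rewrite ?(crg_card shape) // => y cy.
have ra := crg_child_a; have ry : y != r by case/childrenP: cy.
have yq : y \notin subt q.
  apply: crg_children_disjoint (child_subt rootedG cy); rewrite ?crg_child_q //.
  by case/and3P: (crg_neq shape) => qa _ _; rewrite eq_sym.
have [_ up _] := crg_balanced shape yq ry.
have := crg_height shape yq; have dy := dep_child rootedG cy.
rewrite dy (crg_dep1 ra) in up * => h2.
have /andP[lo _] := crg_height_bounds; have := crg_length shape; have := crg_length_gt0.
move: lo; have -> : 2 ^ h = 4 * 2 ^ (h - 2) by rewrite -[in LHS](subnK h2) addn2 !expnS mulnA.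
rewrite expnS in up; move: up; clear; lia.
Qed.

(** The bound on [subt b] excludes vertices at depth [h] there, so all vertices outside [subt a]
    have depth less than [h] and are within [h] of [a]. A pair at distance at least [2 * h - 1]
    makes this radius optimal. *)
Lemma big_child_center :
    D < h -> #|subt b| < 2 ^ h.-1 -> a \in center G.
Proof.
move=> Dh small; have [w [u far]] := crg_far_rgood.
have [ca cb] := (crg_child_a, crg_child_b).
apply: (center_crit connG _ far) => v.
case: (boolP (v \in subt a)) => [va|va].
  apply: leq_trans (dist_subt rootedG va) (leq_trans (leq_subr _ _) _).
  apply: (crg_height shape); apply: crg_children_disjoint va; rewrite ?crg_child_q //.
  by case/and3P: (crg_neq shape) => qa _ _; rewrite eq_sym.
apply: leq_trans (dist_triangle connG r v a) _; rewrite (dist_root rootedG) (dist_sym connG r).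
rewrite (dist_root rootedG) (crg_dep1 ca) addn1.
case: (eqVneq v r) => [->|vr]; first by rewrite (dep_root rootedG) crg_height_gt0.
have [y cy vy] := subt_child rootedG (mem_subt_root rootedG v) vr; move: cy.
rewrite (crg_children shape) !inE -orbA => /or3P[] /eqP ey; rewrite {y}ey in vy.
- by apply: leq_ltn_trans Dh; apply: crg_dep_spine.
- by rewrite vy in va.
have [_ _ topb] := crg_bound (set22 a b).
rewrite ltn_neqAle; apply/andP; split.
  by apply: contraTneq small => /(topb v vy); rewrite -leqNgt.
apply: (crg_height shape); apply: crg_children_disjoint vy; rewrite ?crg_child_q //.
by case/and3P: (crg_neq shape) => _ qb _; rewrite eq_sym.
Qed.

End Shape.

(** * Comparison *)

Lemma exp2_leq_linear h k : 0 < k -> 2 ^ h <= (2 * k).+1 -> h <= k.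
Proof.
move=> k0 le; rewrite leqNgt; apply/negP=> lt_kh.
have := leq_trans (leq_pexp2l (isT : 0 < 2) lt_kh) le; rewrite expnS.
by have := ltn_expl k (isT : 1 < 2); lia.
Qed.

Lemma exp2_leq_add3 h k : 2 < k -> 2 ^ h <= 2 * k + 3 -> h <= k.
Proof.
move=> k2 le; rewrite leqNgt; apply/negP=> lt_kh.
have := leq_trans (leq_pexp2l (isT : 0 < 2) lt_kh) le.
rewrite -(prednK (ltnW (ltnW k2))) !expnS.
by have := ltn_expl k.-1 (isT : 1 < 2); lia.
Qed.

(** Otherwise [h >= k - 1], and [2 ^ (k - 1) = 8 * 2 ^ (k - 4) >= 8 * (k - 3)] exceeds [2 * k + 3]
    from [k = 5] on. *)
Lemma exp2_leq_add3_strong h k : 4 < k -> 2 ^ h <= 2 * k + 3 -> h.+2 <= k.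
Proof.
move=> k4 le; rewrite leqNgt; apply/negP=> lt_kh.
have le_h : (k - 4).+3 <= h by lia.
have := leq_trans (leq_pexp2l (isT : 0 < 2) le_h) le; rewrite !expnS.
by have := ltn_expl (k - 4) (isT : 1 < 2); lia.
Qed.

(** Adding [2 * j] vertices to an rgood tree raises its height by at most [j], because [2 ^ (h +
    j).+1 >= 2 ^ h.+1 * (j + 1) > m + 2 * j]. *)
Lemma exp2_growth h g m j :
  0 < h -> 2 ^ g <= m + 2 * j -> m < 2 ^ h.+1 -> g <= h + j.
Proof.
move=> h0 le lt; rewrite -ltnS -(ltn_exp2l _ _ (isT : 1 < 2)).
apply: leq_ltn_trans le _; rewrite -[(h + j).+1]addSn expnD.
have le_j := leq_mul (leqnn (2 ^ h.+1)) (ltn_expl j (isT : 1 < 2)).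
have le_2 : 2 <= 2 ^ h.+1 by rewrite expnS leq_pmulr // expn_gt0.
have := leq_mul le_2 (leqnn j); rewrite mulnS in le_j; lia.
Qed.

(* The arithmetic behind the case where one child of the root carries more than
   half of the vertices: both subtrees have comparable sizes, so the rgood tree
   is large and the caterpillar short. *)
Lemma big_child_length n m sa sb p D :
    sa.+1 <= 2 * p -> p <= sb.+1 -> (sa + sb).+1 = m -> n.+1 = m + 2 * D ->
    ~~ odd n -> 12 <= n -> n < 2 * sa ->
  2 * D < n %/ 4.
Proof. lia. Qed.

(** * Upper bound for all crg trees *)

Section Upper.
Variables (n m k e l hl : nat).
Hypotheses (nE : n = 4 * k + 2 * e) (e1 : e <= 1) (k3 : 3 <= k).
Hypotheses (m_odd : odd m) (lE : l = 2 * k + 1 + 2 * e).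
Hypotheses (hl_lo : 2 ^ hl <= l).

(** With [m = l - 2 * j] and [D = k + j], the central vertex has depth [i] and a centroid vertex has
    depth [c]. If [c] is not [i], then [c = j] and the distance is at most [i - j = (k - j - h)./2],
    where [hl <= h + j]. *)
Lemma crg_upper_small (G : sgraph) (r : G) par dep q a b z h D :
    crg_shape n m r par dep q a b z h D -> 3 <= m -> m <= l ->
  set_dist (center G) (centroid G) <= (k - hl)./2.
Proof.
move=> shape m3 le_ml; pose j := (l - m)./2.
have nD := crg_length shape; have /andP[h_lo h_up] := crg_height_bounds shape.
have mE : l = m + 2 * j by rewrite /j; clear -m_odd le_ml lE; lia.
have DE : D = k + j by clear -nD mE nE lE; lia.
have hj : hl <= h + j.
  by apply: exp2_growth (crg_height_gt0 shape) _ h_up; rewrite -mE.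
have hK : h <= k + e - j.
  by apply: exp2_leq_linear; [clear -mE lE m3 | apply: leq_trans h_lo _; clear -mE lE m3]; lia.
have hlk : hl <= k.
  by apply: exp2_leq_add3 k3 _; apply: leq_trans hl_lo _; clear -lE e1; lia.
have hk : h <= k.
  by apply: exp2_leq_add3 k3 _; apply: leq_trans h_lo _; clear -lE e1 le_ml; lia.
have hD : h <= D by rewrite DE; apply: leq_trans hk (leq_addr _ _).
(* The bound [hK], from [m = 2 * (k + e - j) + 1], gives [j - e <= i], so [c] is [j] or [j - e],
   close enough to [j] for the centroid. *)
pose i := (D - h)./2; pose c := minn i j.
have iC := spine_center shape hD; rewrite -/i in iC.
have ciD : c <= i <= D by rewrite geq_minl /i; clear; lia.
apply: (@leq_trans (i - c)); last first.
  by rewrite /c /i DE; move: hj hK hD hlk mE lE m3; rewrite DE; clear -e1; lia.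
have cC : spine par z D c \in centroid G; last first.
  exact: leq_trans (set_dist_leq iC cC) (dist_spine shape ciD).
case: (posnP c) => [c0 | c_gt0].
  rewrite c0 (spine0 shape).
  have sq := crg_card_spine shape; have sab := crg_card_rgood shape.
  have ga : 0 < #|subt par dep a| by apply/card_gt0P; exists a; apply: subt_refl.
  have gb : 0 < #|subt par dep b| by apply/card_gt0P; exists b; apply: subt_refl.
  have je : j <= e by move: c0; rewrite /c /i DE; clear -hK e1 mE lE m3; lia.
  by apply: (root_centroid shape); move: sq sab ga gb mE lE nE DE je e1; clear; lia.
have cD : 0 < c <= D by rewrite c_gt0; case/andP: ciD => ? /(leq_trans _); apply.
have [lo up] : c <= j /\ j <= c + e.
  by rewrite /c /i DE; clear -hK e1 mE lE m3; lia.
by apply: (spine_centroid shape cD); move: lo up nE DE e1; clear; lia.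
Qed.

(** Here [a] is in the centroid. If [h <= D], then [2 * D < k] pays for the edge from [r] to [a]; if
    [D < h], then [r] is central and [hl + 2 <= k] suffices. In the remaining case [k <= 4] and [a]
    is central. *)
Lemma crg_upper_big_child (G : sgraph) (r : G) par dep q a b z h D :
    crg_shape n m r par dep q a b z h D -> l < m -> n < 2 * #|subt par dep a| ->
  set_dist (center G) (centroid G) <= (k - hl)./2.
Proof.
move=> shape lt_lm big; have nD := crg_length shape.
have rootedG := crg_rooted shape; have connG := rooted_connect rootedG.
have /andP[h_lo h_up] := crg_height_bounds shape; have h0 := crg_height_gt0 shape.
have D0 := crg_length_gt0 shape; have sab := crg_card_rgood shape.
have [loa upa _] := crg_bound shape (set21 a b).
have [lob upb _] := crg_bound shape (set22 a b).
have hE : 2 ^ h = 2 * 2 ^ h.-1 by rewrite -expnS prednK.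
rewrite hE in upa upb.
have hlh : hl <= h.
  rewrite -ltnS -(ltn_exp2l _ _ (isT : 1 < 2)).
  by apply: leq_ltn_trans hl_lo (ltn_trans lt_lm h_up).
have hlk : 2 ^ hl <= 2 * k + 3.
  by apply: leq_trans hl_lo _; clear -lE e1; lia.
have Dk : 2 * D < k.
  have := big_child_length upa lob sab nD _ _ big.
  have -> : n %/ 4 = k by clear -nE e1; lia.
  by apply; clear -nE k3; lia.
have aC : a \in centroid G by apply: (child_centroid shape); apply: ltnW.
have ra : dist r a <= 1.
  by apply: dist_adj; apply: (adj_child rootedG); apply: (crg_child_a shape).
case: (leqP h D) => [hD|Dh].
  have iC := spine_center shape hD.
  apply: leq_trans (set_dist_leq iC aC) _.
  apply: leq_trans (dist_triangle connG r _ _) _.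
  have iD : 0 <= (D - h)./2 <= D by clear; lia.
  have := dist_spine shape iD; rewrite (spine0 shape) subn0 => le_i.
  apply: leq_trans (leq_add le_i ra) _; clear -hD Dk hlh k3; lia.
case: (leqP hl.+2 k) => [hlk2|khl].
  have rC := root_center shape (ltnW Dh).
  apply: leq_trans (set_dist_leq rC aC) (leq_trans ra _).
  by clear -hlk2; lia.
have k4 : k <= 4.
  rewrite leqNgt; apply/negP=> k4; have := exp2_leq_add3_strong k4 hlk.
  by rewrite leqNgt khl.
have aM : a \in center G.
  apply: (big_child_center shape Dh); rewrite ltnNge; apply/negP=> leb.
  (* Let [p = 2 ^ h.-1], and recall [n <= 18]. If [p <= 4], then [#|subt a| = 7] and [n = 12]; if
     [8 <= p], both subtrees are large. Either way they have too many vertices together. *)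
  have p_pow : 2 ^ h.-1 <= 4 \/ 8 <= 2 ^ h.-1.
    case: (leqP h.-1 2) => le2; [left | right].
      by rewrite -[4]/(2 ^ 2) leq_pexp2l.
    by rewrite -[8]/(2 ^ 3) leq_pexp2l.
  move: upa leb sab nD big p_pow m_odd k4 nE e1 D0; clear.
  by move: (2 ^ _) => p; lia.
by apply: leq_trans (set_dist_leq aM aC) _; rewrite distxx.
Qed.

Lemma crg_upper (G : sgraph) (r : G) par dep q a b z h D :
    crg_shape n m r par dep q a b z h D -> 3 <= m ->
  set_dist (center G) (centroid G) <= (k - hl)./2.
Proof.
move=> shape m3; case: (leqP m l) => [|lt_lm]; first exact: crg_upper_small shape m3.
case: (leqP (2 * #|subt par dep a|) n) => [sa|]; last exact: crg_upper_big_child shape lt_lm.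
case: (leqP (2 * #|subt par dep b|) n) => [sb|].
  have nD := crg_length shape; have sq := crg_card_spine shape.
  have /andP[h_lo h_up] := crg_height_bounds shape.
  have rC : r \in centroid G.
    by apply: (root_centroid shape) => //; move: sq nD lt_lm lE nE; clear; lia.
  case: (leqP D h) => [/(root_center shape) rM|/ltnW hD].
    by apply: leq_trans (set_dist_leq rM rC) _; rewrite distxx.
  have iC := spine_center shape hD.
  have iD : 0 <= (D - h)./2 <= D by clear; lia.
  have := dist_spine shape iD; rewrite (spine0 shape) subn0 => le_i.
  apply: leq_trans (set_dist_leq iC rC) (leq_trans le_i _).
  (* More vertices than in the tree with parameter [l] mean at least its height, and [l < m] also
     gives [D < k]. *)
  have hlh : hl <= h.
    rewrite -ltnS -(ltn_exp2l _ _ (isT : 1 < 2)).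
    by apply: leq_ltn_trans hl_lo (ltn_trans lt_lm h_up).
  by move: hlh nD lt_lm lE nE; clear; lia.
exact: (crg_upper_big_child (crg_shape_swap shape)).
Qed.

End Upper.

(** * Lower bound for the extremal tree and conclusion *)

Lemma crg_lower n k e (G : sgraph) (r : G) par dep q a b z h D :
    n = 4 * k + 2 * e -> e <= 1 -> 3 <= k ->
    crg_shape n (2 * k + 1 + 2 * e) r par dep q a b z h D ->
  (k - h)./2 <= set_dist (center G) (centroid G).
Proof.
move=> nE e1 k3 shape; have nD := crg_length shape; have cG := crg_card shape.
have DE : D = k by clear -nD nE; lia.
have sq := crg_card_spine shape; have sab := crg_card_rgood shape.
have [loa upa _] := crg_bound shape (set21 a b).
have [lob upb _] := crg_bound shape (set22 a b).
have /andP[h_lo h_up] := crg_height_bounds shape; have h0 := crg_height_gt0 shape.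
have p_lo : 2 * k + 1 + 2 * e < 4 * 2 ^ h.-1.
  by apply: leq_trans h_up _; rewrite -(prednK h0) !expnS mulnA.
apply: leq_set_dist => [|x y xC yC]; first by rewrite cG nE; clear; lia.
(* Each of [subt a] and [subt b] has more than [e] of their [2 * k + 2 * e] vertices, so the other
   has fewer than [n / 2 = 2 * k + e]; [subt q] has [2 * k - 1]. *)
have -> : y = r.
  by apply: (root_centroid_unique shape) yC; move: sq sab loa lob p_lo DE nE e1 k3; clear; lia.
by rewrite -DE; apply: (center_dist_root shape).
Qed.

Theorem theorem3p2 (n l : nat) (n_ge12 : 12 <= n) (n_even : ~~ odd n)
    (l_def : l = 2 * ceil_divn n 4 + 1)
    (m : nat) (m_odd : odd m) (m_range : 3 <= m < n)
    (G H : sgraph) (G_crg : is_crg n m G) (H_crg : is_crg n l H) :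
  set_dist (center G) (centroid G) <= set_dist (center H) (centroid H).
Proof.
pose k := n %/ 4; pose e := (n %% 4)./2.
have nE : n = 4 * k + 2 * e by rewrite /k /e; clear -n_even; lia.
have e1 : e <= 1 by rewrite /e; clear; lia.
have k3 : 3 <= k by rewrite /k; clear -n_ge12; lia.
(* The quotient [n / 4] rounded up is [k + e]. *)
have lE : l = 2 * k + 1 + 2 * e.
  by rewrite l_def /ceil_divn; clear -nE e1; lia.
have [rG [pG [dG [qG [aG [bG [zG [hG [DG shG]]]]]]]]] := is_crg_shape G_crg.
have [rH [pH [dH [qH [aH [bH [zH [hH [DH shH]]]]]]]]] := is_crg_shape H_crg.
have /andP[hl_lo _] := crg_height_bounds shH; have /andP[m3 _] := m_range.
rewrite lE in shH hl_lo.
apply: leq_trans (crg_lower nE e1 k3 shH).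
exact: (crg_upper nE e1 k3 m_odd erefl hl_lo shG m3).
Qed.
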